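(* For every $n\ge1$, the poset $\mathrm{Tub}(F_{1,n})$ of tubings on the fan graph $F_{1,n}$ is isomorphic to the poset, under the painted growth order, of painted trees with $n+1$ leaves consisting of forests of plane trees grafted to weakly ordered trees.
   Context: **Tubings.** For a finite connected simple graph $G$, a tube is a nonempty set of nodes inducing a connected subgraph; the set of all nodes is the universal tube. Two tubes $u,v$ are compatible if one is contained in the other or if $u\cup v$ is not a tube (and $u,v$ disjoint). A tubing is a set of pairwise compatible tubes containing the universal tube. $\mathrm{Tub}(G)$ is the set of tubings ordered by $U\preceq U'$ iff $U'\subseteq U$. (It is the face poset of the graph associahedron $\mathcal{K}G$; $\mathcal{K}F_{1,n}$ is the pterahedron.) The fan graph $F_{1,n}$ has nodes $0,1,\dots,n$ and edges $\{i,i+1\}$ for $1\le i\le n-1$ and $\{0,i\}$ for $1\le i\le n$. **Plane and painted trees.** A plane tree is a finite rooted plane tree in which every node has at least two (linearly ordered) inputs; inputs not coming from another node are leaves, numbered $0,1,\dots,n$ from left to right; the root has an output edge. A node $w$ is strictly above a node $v$ if $v\neq w$ lies on the path from $w$ to the root. A weak order on a set of nodes is a total preorder (an ordered partition into levels), always required to satisfy: if $w$ is strictly above $v$ then the level of $w$ comes strictly after the level of $v$. A painted tree is a plane tree each of whose nodes is declared painted, half-painted or unpainted, such that if $w$ is strictly above $v$ and $v$ is half-painted or unpainted, then $w$ is unpainted. Let $W_n$ be the set of painted trees with $n+1$ leaves equipped with a weak order on the painted nodes and a weak order on all unpainted nodes. A forest of plane trees grafted to a weakly ordered tree is a painted tree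 equipped with a weak order on the painted nodes only; let $X_n$ be the set of those with $n+1$ leaves. The forgetful map $p:W_n\to X_n$ forgets the weak order of the unpainted nodes. **Painted growth order.** For $t\in W_n$, gap $i$ ($1\le i\le n$) ends at the node where the paths from leaves $i-1$ and $i$ to the root first meet. $\pi(t)$ is the ordered partition of $\{0,\dots,n\}$ listing: in order, the blocks of gaps ending at painted nodes of each level; then the block of $0$ and all gaps ending at half-painted nodes; then, in order, the blocks of gaps ending at unpainted nodes of each level. $\pi(s)$ refines $\pi(t)$ if it is obtained by replacing each block by an ordered partition of that block. A growth step in $X_n$ (growing internal edges, then forgetting superfluous structure) passes from $x$ to $y$ if there are $t,s\in W_n$ with $p(t)=x$, $p(s)=y$ and $\pi(s)$ refining $\pi(t)$. Then $y\preceq x$ iff $y$ is obtained from $x$ by a finite (possibly empty) sequence of growth steps. *)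

(* Defs.v *)
From mathcomp Require Import all_boot.
From Stdlib Require Import Relation_Operators.

Set Implicit Arguments.
Unset Strict Implicit.
Unset Printing Implicit Defensive.

Section Tubings.

Variables (T : finType) (e : rel T).

Definition tube (A : {set T}) : bool :=
  (A != set0) && [forall x in A, forall y in A, connect [rel u v in A | e u v] x y].

Definition compatible (A B : {set T}) : bool :=
  [|| A \subset B, B \subset A | [disjoint A & B] && ~~ tube (A :|: B)].

Definition tubing (U : {set {set T}}) : bool :=
  [&& [set: T] \in U, [forall A in U, tube A]
    & [forall A in U, forall B in U, compatible A B]].

Definition Tub := {U : {set {set T}} | tubing U}.

Definition tub_le (U U' : Tub) : bool := val U' \subset val U.

End Tubings.

Definition fan (n : nat) : rel 'I_n.+1 :=
  fun i j =>
    [|| (0 < i) && (j == i.+1 :> nat), (0 < j) && (i == j.+1 :> nat),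
        (i == 0 :> nat) && (0 < j) | (j == 0 :> nat) && (0 < i)].

Lemma fan_sym n : symmetric (@fan n).
Proof.
move=> i j; rewrite /fan orbCA; do 2!congr (_ || _); exact: orbC.
Qed.

Lemma fan_irrefl n : irreflexive (@fan n).
Proof.
by move=> i; rewrite /fan (ltn_eqF (ltnSn i)) andbF /=; case: (nat_of_ord i).
Qed.

Inductive tree (A : Type) : Type :=
| Leaf
| Node of A & seq (tree A).
Arguments Leaf {A}.

(* Nodes and leaves are addressed by the sequence of child indices leading to *)
(* them from the root, so the nodes on the path from p to the root are the    *)
(* prefixes of p.                                                             *)
Definition address := seq nat.

Definition graft (ps : seq (seq address)) : seq address :=
  flatten [seq [seq ip.1 :: p | p <- ip.2] | ip <- zip (iota 0 (size ps)) ps].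

Section Trees.

Variable A : Type.
Implicit Types (t : tree A) (v w p : address).

Fixpoint leaves t : seq address :=
  if t is Node _ ts then graft (map leaves ts) else [:: [::]].

Fixpoint nodes t : seq address :=
  if t is Node _ ts then [::] :: graft (map nodes ts) else [::].

Fixpoint label t p : option A :=
  match t, p with
  | Node a _, [::] => Some a
  | Node _ ts, i :: q => nth (fun=> None) (map label ts) i q
  | Leaf, _ => None
  end.

Definition labels t : seq A := pmap (label t) (nodes t).

Fixpoint plane t : bool :=
  if t is Node _ ts then (1 < size ts) && all plane ts else true.

Definition strictly_above w v : bool := (v != w) && prefix v w.

(* [r] relates the label of each node to those of the nodes strictly above it. *)
Definition all_above (r : A -> A -> bool) t : bool :=
  all (fun v => all (fun w => strictly_above w v ==>
    (if (label t v, label t w) is (Some a, Some b) then r a b else true))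
    (nodes t)) (nodes t).

(* A weak order on the nodes whose label has a level is stored by numbering   *)
(* its levels consecutively from 0; as no number is skipped, distinct         *)
(* numberings are distinct weak orders.                                       *)
Definition levels (lev : A -> option nat) t : seq nat := pmap lev (labels t).

Definition weak_order (lev : A -> option nat) t : bool :=
  all (fun k => all (mem (levels lev t)) (iota 0 k)) (levels lev t) &&
  all_above (fun a b =>
    if (lev a, lev b) is (Some k, Some l) then k < l else true) t.

Definition n_levels (lev : A -> option nat) t : nat :=
  size (undup (levels lev t)).

Fixpoint common_prefix p q : address :=
  match p, q with
  | i :: p', j :: q' => if i == j then i :: common_prefix p' q' else [::]
  | _, _ => [::]
  end.

Definition gap_end t (i : nat) : address :=
  common_prefix (nth [::] (leaves t) i.-1) (nth [::] (leaves t) i).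

End Trees.

Fixpoint tree_map (A B : Type) (f : A -> B) (t : tree A) : tree B :=
  if t is Node a ts then Node (f a) (map (tree_map f) ts) else Leaf.

(* Painted and unpainted nodes carry extra data in [P] and [U]: their level   *)
(* number, or nothing.                                                        *)
Inductive paint (P U : Type) : Type :=
| Painted of P
| HalfPainted
| Unpainted of U.
Arguments HalfPainted {P U}.
Arguments Unpainted {P U}.

Section Paint.

Variables P U : Type.
Implicit Types a b : paint P U.

Definition painted a : option P := if a is Painted k then Some k else None.
Definition half_painted a : bool := if a is HalfPainted then true else false.
Definition unpainted a : option U := if a is Unpainted k then Some k else None.

Definition painted_tree (t : tree (paint P U)) : bool :=
  plane t && all_above (fun a b => ~~ isSome (painted a) ==> isSome (unpainted b)) t.

End Paint.

Definition is_W (n : nat) (t : tree (paint nat nat)) : bool :=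
  [&& painted_tree t, size (leaves t) == n.+1,
      weak_order (@painted _ _) t & weak_order (@unpainted _ _) t].

Definition W (n : nat) := {t : tree (paint nat nat) | is_W n t}.

Definition is_X (n : nat) (x : tree (paint nat unit)) : bool :=
  [&& painted_tree x, size (leaves x) == n.+1 & weak_order (@painted _ _) x].

Definition X (n : nat) := {x : tree (paint nat unit) | is_X n x}.

Definition forget_unpainted (a : paint nat nat) : paint nat unit :=
  match a with
  | Painted k => Painted unit k
  | HalfPainted => HalfPainted
  | Unpainted _ => Unpainted tt
  end.

Section TreeInd.

Variables (A : Type) (Q : tree A -> Prop).
Hypothesis QLeaf : Q Leaf.
Hypothesis QNode : forall a ts, foldr (fun t => and (Q t)) True ts -> Q (Node a ts).

Fixpoint tree_ind_all (t : tree A) : Q t :=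
  match t with
  | Leaf => QLeaf
  | Node a ts => QNode a ((fix loop ts : foldr (fun t => and (Q t)) True ts :=
      if ts is t :: ts' then conj (tree_ind_all t) (loop ts') else I) ts)
  end.

End TreeInd.

Section TreeMap.

Variables (A B : Type) (f : A -> B).

Lemma leaves_map t : leaves (tree_map f t) = leaves t.
Proof.
elim/tree_ind_all: t => //= a ts IH; congr graft.
by elim: ts IH => //= t ts IHts [-> /IHts ->].
Qed.

Lemma nodes_map t : nodes (tree_map f t) = nodes t.
Proof.
elim/tree_ind_all: t => //= a ts IH; congr (_ :: graft _).
by elim: ts IH => //= t ts IHts [-> /IHts ->].
Qed.

Lemma plane_map t : plane (tree_map f t) = plane t.
Proof.
elim/tree_ind_all: t => //= a ts IH; rewrite size_map; congr (_ && _).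
by elim: ts IH => //= t ts IHts [-> /IHts ->].
Qed.

Lemma label_map t p : label (tree_map f t) p = omap f (label t p).
Proof.
elim/tree_ind_all: t p => //= a ts IH [|i p] //=.
elim: ts i IH => [|t ts IHts] [|i] //= [IHt IH]; first exact: IHt.
exact: IHts.
Qed.

Lemma all_above_map r t :
  all_above r (tree_map f t) = all_above (fun a b => r (f a) (f b)) t.
Proof.
rewrite /all_above nodes_map; apply: eq_all => v; apply: eq_all => w.
by rewrite !label_map; case: (label t v) => //= a; case: (label t w).
Qed.

Lemma levels_map lev t : levels lev (tree_map f t) = levels (lev \o f) t.
Proof.
rewrite /levels /labels nodes_map; elim: (nodes t) => //= v s IHs.
by rewrite label_map; case: (label t v) => //= a; rewrite IHs.
Qed.

End TreeMap.

Lemma eq_all_above A (r r' : A -> A -> bool) t :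
  r =2 r' -> all_above r t = all_above r' t.
Proof.
move=> rr'; apply: eq_all => v; apply: eq_all => w.
by case: (label t v) => // a; case: (label t w) => // b; rewrite rr'.
Qed.

Lemma forget_subproof n (t : W n) : is_X n (tree_map forget_unpainted (val t)).
Proof.
case: t => t /= /and4P[/andP[plt abv] szt wo _].
rewrite /is_X /painted_tree plane_map plt leaves_map szt /weak_order /=.
have Dlev : levels (@painted _ _) (tree_map forget_unpainted t)
          = levels (@painted _ _) t.
  by rewrite levels_map /levels; apply: eq_pmap; case.
rewrite Dlev !all_above_map; case/andP: wo => -> wo /=; apply/andP; split.
  by apply: etrans abv; apply: eq_all_above => -[?||?] [?||?].
by apply: etrans wo; apply: eq_all_above => -[?||?] [?||?].
Qed.

Definition forget n (t : W n) : X n := Sub _ (forget_subproof t).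

Definition ordered_partition (T : finType) (B : {set T}) (s : seq {set T}) : bool :=
  uniq s && partition [set:: s] B.

Definition refines (T : finType) (s t : seq {set T}) : Prop :=
  exists2 ss : seq (seq {set T}), s = flatten ss & all2 (@ordered_partition T) t ss.

Definition growth_partition n (t : W n) : seq {set 'I_n.+1} :=
  let ends_at (i : 'I_n.+1) := label (val t) (gap_end (val t) i) in
  [seq [set i : 'I_n.+1 | (0 < i) && (obind (@painted _ _) (ends_at i) == Some k)]
     | k <- iota 0 (n_levels (@painted _ _) (val t))]
  ++ [set i : 'I_n.+1 | (i == ord0) || oapp (@half_painted _ _) false (ends_at i)]
  :: [seq [set i : 'I_n.+1 | (0 < i) && (obind (@unpainted _ _) (ends_at i) == Some k)]
     | k <- iota 0 (n_levels (@unpainted _ _) (val t))].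

Definition growth_step n (x y : X n) : Prop :=
  exists t s : W n,
    [/\ forget t = x, forget s = y
      & refines (growth_partition s) (growth_partition t)].

Definition growth_le n (y x : X n) : Prop := clos_refl_trans _ (@growth_step n) x y.

(* Main.v *)
Require Import Defs.
From mathcomp Require Import all_boot.
From mathcomp Require Import zify.
From Stdlib Require Import Relation_Operators.

Set Implicit Arguments.
Unset Strict Implicit.
Unset Printing Implicit Defensive.

(* The tubes of F_{1,n} are the sets containing 0 and the intervals of        *)
(* {1, ..., n}. A ranking h of the graph nodes yields the tubing of all tubes *)
(* A such that every neighbour of A outside A has smaller rank than all of A; *)
(* refining the ranking adds tubes. Elements of W_n are exactly the rankings  *)
(* of {0, ..., n} without skipped values (0 having the rank of the            *)
(* half-painted nodes), pi(t) being the list of level sets of the ranking,    *)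
(* and two of them have the same image in X_n iff they yield the same tubing. *)
(* Conversely a tubing is recovered from any ranking that is strictly         *)
(* monotone in the set of tubes containing a node, such as the number of      *)
(* these tubes. For tubings V contained in U, ranking by V first and then by  *)
(* U refines the ranking by V, so U is reached from V in one growth step.     *)

(** * Gaps of a plane tree *)

(** A plane tree whose labels strictly increase upwards carries the same information as the word of
    labels met at its gaps: [ordered_gaps_inj] recovers the tree and [buildP] builds one from any
    word. By [is_WP] the painting rule and the two weak orders of an element of [W n] amount to one
    such increase of [rank_label], so elements of [W n] are rankings of the graph nodes.
    [growth_partitionE] and [refines_level_setsP] then turn refinement into preservation of strict
    inequalities of ranks.

    On the graph side, [valley_tubes] maps rankings to tubings ([valley_tubes_tubing]), is monotone
    under refinement ([valley_tubes_sub]) and reaches every tubing ([valley_tubes_compat]).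

    The core is that two elements of [W n] have the same valley tubes exactly when they have the
    same image in [X n] ([forget_valley], [valley_forget]). As 0 is adjacent to all other nodes, a
    tubing sees all comparisons with ranks at most that of 0 ([leq_rank_low]). It also sees, for
    each [i > 0], the largest interval of positive nodes around [i] on which no rank is below that
    of [i] ([above_tubesP]). The forgotten tree keeps the same data: its painted levels and
    half-painted nodes give the low ranks, and by [rank_extentP] the intervals are the extents of
    its nodes. The extents shrink strictly upwards ([extents_ordered]), so they in turn determine
    the shape of the tree.

    Hence the valley tubes of any lift of a tree and the tree of the ranking by number of tubes are
    mutually inverse constructions. Growth steps only add tubes ([growth_step_sub]), and an
    inclusion of tubings is realised by a single growth step ([tub_le_growth_step]). *)

Definition grafted_from k (ps : seq (seq address)) : seq address :=
  flatten [seq [seq ip.1 :: p | p <- ip.2] | ip <- zip (iota k (size ps)) ps].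

Arguments grafted_from : simpl never.

Lemma grafted_from_cons k p ps :
  grafted_from k (p :: ps) = map (cons k) p ++ grafted_from k.+1 ps.
Proof. by []. Qed.

Lemma mem_grafted_from k ps v :
  (v \in grafted_from k ps) =
  if v is i :: q then (k <= i) && (q \in nth [::] ps (i - k)) else false.
Proof.
elim: ps k v => [|p ps IH] k v.
  by case: v => // i q; rewrite nth_nil andbF.
rewrite grafted_from_cons mem_cat IH; case: v => [|i q].
  by rewrite orbF; apply/mapP=> -[].
have -> : (i :: q \in map (cons k) p) = (i == k) && (q \in p).
  apply/mapP/andP => [[r rp [-> ->]]|[/eqP-> qp]]; last by exists q.
  by rewrite eqxx.
case: (ltngtP k i) => [ki|ik|->] /=; last by rewrite subnn orbF.
  by rewrite -(subnSK ki).
by [].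
Qed.

Lemma graftE ps : graft ps = grafted_from 0 ps.
Proof. by []. Qed.

Lemma mem_graft ps v :
  (v \in graft ps) = if v is i :: q then q \in nth [::] ps i else false.
Proof. by rewrite graftE mem_grafted_from; case: v => // i q; rewrite subn0. Qed.

Section Gaps.

Variable A : Type.
Implicit Types (t : tree A) (ts : seq (tree A)) (a : A).

(** The labels of the nodes where the gaps end, from left to right. A gap between consecutive
    children ends at their parent, so the root label separates the lists of the children; [behead]
    drops the separator before the first child. *)
Fixpoint gaps t : seq A :=
  if t is Node a ts then behead (flatten [seq a :: s | s <- map gaps ts]) else [::].

Lemma gaps_node a t ts :
  gaps (Node a (t :: ts)) = gaps t ++ flatten [seq a :: gaps u | u <- ts].
Proof. by rewrite /= -map_comp. Qed.

Lemma cons_gaps_node a ts : 0 < size ts ->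
  a :: gaps (Node a ts) = flatten [seq a :: gaps u | u <- ts].
Proof. by case: ts => // t ts _; rewrite gaps_node. Qed.

(** A recursive, address-free form of [all_above]; the two agree on plane trees by [all_aboveE]. *)
Fixpoint ordered (r : rel A) t : bool :=
  if t is Node a ts then all (all (r a)) (map gaps ts) && all (ordered r) ts
  else true.

Lemma tree_ind_nth (Q : tree A -> Prop) :
  Q Leaf ->
  (forall a ts, (forall i, i < size ts -> Q (nth Leaf ts i)) -> Q (Node a ts)) ->
  forall t, Q t.
Proof.
move=> QL QN; elim/tree_ind_all=> // a ts IH; apply: QN.
elim: ts IH => [|t ts IHts] //= [Qt /IHts Qts] [|i] //=; exact: Qts.
Qed.

Lemma label_node_cat a us t ts q :
  label (Node a (us ++ t :: ts)) (size us :: q) = label t q.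
Proof. by rewrite /= map_cat nth_cat size_map ltnn subnn. Qed.

Lemma label_node a ts i q : label (Node a ts) (i :: q) = label (nth Leaf ts i) q.
Proof.
rewrite /=; case: (ltnP i (size ts)) => [i_lt|i_ge]; first by rewrite (nth_map Leaf).
by rewrite !nth_default ?size_map.
Qed.

Lemma labels_node a ts : labels (Node a ts) = a :: flatten (map (@labels A) ts).
Proof.
rewrite /labels /=; congr (_ :: _).
suff H us : pmap (label (Node a (us ++ ts))) (grafted_from (size us) (map (@nodes A) ts)) =
    flatten (map (@labels A) ts) by exact: (H [::]).
elim: ts us => // t ts IH us.
rewrite [map _ _]/= grafted_from_cons pmap_cat.
have -> : (size us).+1 = size (rcons us t) by rewrite size_rcons.
rewrite [RHS]/= -(IH (rcons us t)) cat_rcons; congr (_ ++ _).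
by rewrite /labels; elim: (nodes t) => //= v s ->; rewrite map_cat nth_cat size_map ltnn subnn.
Qed.

Lemma all_flatten_map (B : Type) (p : pred B) (f : tree A -> seq B) ts :
  all p (flatten (map f ts)) = all (fun t => all p (f t)) ts.
Proof. by elim: ts => //= t ts IH; rewrite all_cat IH. Qed.

Lemma all_gaps_node (p : pred A) a ts : 1 < size ts ->
  all p (gaps (Node a ts)) = p a && all (fun t => all p (gaps t)) ts.
Proof.
case: ts => [|t [|u ts]] // _.
rewrite gaps_node all_cat !all_flatten_map /=.
by case: (p a); rewrite /= ?andbF.
Qed.

(** A node of a plane tree has at least two children and so ends at least one gap: [labels] and
    [gaps] have the same elements, with different multiplicities. *)
Lemma all_labels (p : pred A) t : plane t -> all p (labels t) = all p (gaps t).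
Proof.
elim/tree_ind_nth: t => // a ts IH /andP[sz pl].
rewrite labels_node (all_gaps_node _ _ sz) [all _ (_ :: _)]/= all_flatten_map; congr andb.
elim: ts {sz} IH pl => //= t ts IHts IH /andP[pt pts].
by rewrite (IH 0) // IHts // => i; apply: (IH i.+1).
Qed.

Lemma all_pmap_oapp (B : Type) (f : address -> option B) (p : pred B) s :
  all p (pmap f s) = all (fun w => oapp p true (f w)) s.
Proof. by elim: s => //= x s IH; case: (f x) => //= b; rewrite IH. Qed.

(** One address is a prefix of another only if it is the root or both lie in the same child, so the
    condition splits along the children. *)
Lemma all_above_node (r : rel A) a ts :
  all_above r (Node a ts) =
  all (r a) (flatten (map (@labels A) ts)) && all (all_above r) ts.
Proof.
have -> : flatten (map (@labels A) ts) =
  pmap (label (Node a ts)) (graft (map (@nodes A) ts)).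
  by have [] := labels_node a ts.
rewrite all_pmap_oapp /all_above.
have -> : nodes (Node a ts) = [::] :: graft (map (@nodes A) ts) by [].
set f := label (Node a ts).
have f0 : f [::] = Some a by [].
have fi i q : f (i :: q) = label (nth Leaf ts i) q by apply: label_node.
clearbody f; rewrite /= f0 /=; congr (_ && _).
  by apply: eq_in_all => w; rewrite mem_graft; case: w.
apply/allP/(all_nthP Leaf) => [H i i_lt|H v].
  apply/allP => v v_in; apply/allP => w w_in.
  have nth_nodes u : u \in nodes (nth Leaf ts i) ->
      i :: u \in graft [seq nodes t | t <- ts].
    by rewrite mem_graft (nth_map Leaf).
  have /andP[_ /allP/(_ _ (nth_nodes _ w_in))] := H _ (nth_nodes _ v_in).
  by rewrite !fi /strictly_above /= eqseq_cons eqxx.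
rewrite mem_graft; case: v => // i v v_in; apply/andP; split; first by [].
apply/allP => w; rewrite mem_graft; case: w => // j w w_in.
rewrite /strictly_above prefix_cons eqseq_cons !fi.
case: eqP => [ij|//] /=; subst j.
case: (ltnP i (size ts)) => [i_lt|i_ge]; last first.
  by move: v_in; rewrite nth_default ?size_map.
move: v_in w_in; rewrite !(nth_map Leaf) // => v_in w_in.
by have /allP/(_ _ v_in)/allP/(_ _ w_in) := H _ i_lt.
Qed.

Lemma all_aboveE (r : rel A) t : plane t -> all_above r t = ordered r t.
Proof.
elim/tree_ind_nth: t => // a ts IH /= /andP[_ pl].
rewrite all_above_node all_flatten_map all_map.
have pln i : i < size ts -> plane (nth Leaf ts i) by move=> lti; apply: all_nthP.
congr (_ && _).
  elim: ts pl {IH pln} => //= t ts IHts /andP[pt /IHts ->]; congr (_ && _).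
  exact: all_labels.
elim: ts IH pln {pl} => //= t ts IHts IH pln; rewrite (IH 0) ?(pln 0) // IHts // => i.
  exact: (IH i.+1).
exact: (pln i.+1).
Qed.

Lemma size_leaves_gt0 t : plane t -> 0 < size (leaves t).
Proof.
elim/tree_ind_nth: t => // a [|t ts] // IH /= /andP[_ /andP[pt _]].
rewrite /graft /= size_cat.
by apply: leq_trans (leq_addr _ _); rewrite size_map; exact: (IH 0 isT pt).
Qed.

Definition ends (l : seq address) : seq address :=
  if l is x :: l' then pairmap common_prefix x l' else [::].

Lemma ends_map_cons k l : ends (map (cons k) l) = map (cons k) (ends l).
Proof.
case: l => //= x l; elim: l x => //= y l IH x; by rewrite eqxx IH.
Qed.

Lemma ends_cat k l l' : 0 < size l ->
  (if l' is (j :: _) :: _ then k != j else false) ->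
  ends (map (cons k) l ++ l') = map (cons k) (ends l) ++ [::] :: ends l'.
Proof.
case: l => // x l _; case: l' => // -[//|j y] l' kj /=.
elim: l x => [|z l IH] x /=; first by rewrite (negbTE kj).
by rewrite eqxx IH.
Qed.

Lemma size_leaves t : plane t -> size (leaves t) = (size (gaps t)).+1.
Proof.
elim/tree_ind_nth: t => // a ts IH /= /andP[sz pl].
have pln i : i < size ts -> plane (nth Leaf ts i) by move=> lti; apply: all_nthP.
have H us k : (forall i, i < size us -> size (leaves (nth Leaf us i)) =
    (size (gaps (nth Leaf us i))).+1) ->
  size (grafted_from k [seq leaves i | i <- us]) = size (flatten [seq a :: gaps u | u <- us]).
  elim: us k => [|u us IHu] k Hu; first by [].
  rewrite [map _ _]/= grafted_from_cons size_cat size_map (IHu k.+1) => [|i]; last exact: (Hu i.+1).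
  by rewrite (Hu 0) //= size_cat.
rewrite graftE H; last by move=> i lti; apply: IH => //; apply: pln.
by rewrite -cons_gaps_node // ltnW.
Qed.

(** The last leaf of a child and the first leaf of the next one have paths meeting at the parent,
    whose label [gaps] puts between the two children. *)
Lemma label_ends t : plane t -> map (label t) (ends (leaves t)) = map Some (gaps t).
Proof.
elim/tree_ind_nth: t => // a ts IH /= /andP[sz pl].
have pln i : i < size ts -> plane (nth Leaf ts i) by move=> lti; apply: all_nthP.
have {}IH i : i < size ts -> map (label (nth Leaf ts i)) (ends (leaves (nth Leaf ts i)))
   = map Some (gaps (nth Leaf ts i)) by move=> lti; apply: IH => //; apply: pln.
have lv i : i < size ts -> 0 < size (leaves (nth Leaf ts i)).
  by move=> /pln/size_leaves_gt0.
rewrite -map_comp (_ : map _ ts = [seq a :: gaps u | u <- ts]); last exact: eq_map.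
(* The children [us] already passed are kept, because addresses contain the index of a child among
   all its siblings. *)
suff H us : map (label (Node a (us ++ ts))) (ends (grafted_from (size us) (map (@leaves A) ts))) =
    map Some (behead (flatten [seq a :: gaps u | u <- ts])) by exact: (H [::]).
have {sz} : 0 < size ts by apply: ltnW.
elim: ts us IH lv {pln pl} => // t ts IHts us IH lv _.
have Hk : map (label (Node a (us ++ t :: ts))) (map (cons (size us)) (ends (leaves t)))
    = map Some (gaps t).
  rewrite -(IH 0) // -map_comp; apply: eq_map => q.
  by rewrite [RHS]/= -(label_node_cat a us t ts).
case: ts IHts IH lv Hk => [|u ts] IHts IH lv Hk.
  have -> : grafted_from (size us) (map (@leaves A) [:: t]) =
      map (cons (size us)) (leaves t) by apply: cats0.
  by rewrite ends_map_cons Hk /= cats0.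
rewrite map_cons grafted_from_cons ends_cat; first last.
- rewrite map_cons grafted_from_cons; have /= := lv 1 isT.
  by case: (leaves u) => //= x l _; rewrite neq_ltn ltnSn.
- exact: (lv 0).
rewrite map_cat Hk map_cons.
have := IHts (rcons us t) (fun i => IH i.+1) (fun i => lv i.+1) isT.
rewrite cat_rcons size_rcons => E.
have -> : behead (flatten [seq a :: gaps v | v <- [:: t, u & ts]]) =
  gaps t ++ a :: behead (flatten [seq a :: gaps v | v <- u :: ts]) by [].
by rewrite map_cat !map_cons; congr (_ ++ _ :: _); exact: E.
Qed.

Lemma label_gap_end t i : plane t -> i < size (gaps t) ->
  label t (gap_end t i.+1) = nth None (map Some (gaps t)) i.
Proof.
move=> pt lti; rewrite -label_ends // /gap_end /=.
have := size_leaves pt; case: (leaves t) => //= x l [szl].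
by rewrite (nth_map [::]) ?size_pairmap ?szl // (nth_pairmap [::]) ?szl.
Qed.

End Gaps.

Lemma gaps_map (A B : Type) (f : A -> B) t : gaps (tree_map f t) = map f (gaps t).
Proof.
elim/tree_ind_all: t => //= a ts IH; rewrite -behead_map; congr behead.
elim: ts IH => //= t ts IHts [-> /IHts ->].
by rewrite map_cat.
Qed.

Lemma ordered_map (A B : Type) (f : A -> B) (r : rel B) t :
  ordered r (tree_map f t) = ordered (fun a b => r (f a) (f b)) t.
Proof.
elim/tree_ind_all: t => //= a ts IH.
congr (_ && _); first by elim: ts {IH} => //= t ts ->; rewrite gaps_map all_map.
by elim: ts IH => //= t ts IHts [-> /IHts ->].
Qed.

(** * Tubings from rankings *)

Section Graph.

Variables (T : finType) (e : rel T).
Hypothesis e_sym : symmetric e.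
Implicit Types (A B : {set T}) (U : {set {set T}}) (h : T -> nat).

Lemma tubeP A :
  reflect (A != set0 /\
           {in A &, forall x y, connect [rel u v in A | e u v] x y}) (tube e A).
Proof.
apply: (iffP andP) => -[A0 conA]; split=> //.
  by move=> x y xA yA; have /forall_inP/(_ _ xA)/forall_inP/(_ _ yA) := conA.
by apply/forall_inP => x xA; apply/forall_inP => y yA; apply: conA.
Qed.

Lemma connect_exit (r : rel T) x y (P : pred T) :
  connect r x y -> P x -> ~~ P y -> exists u v, [/\ r u v, P u & ~~ P v].
Proof.
case/connectP => p; elim: p x => [|z p IH] x /=; first by move=> _ -> ->.
case/andP=> rxz pz ey Px nPy; case Pz: (P z); last by exists x, z; rewrite rxz Px Pz.
exact: (IH z).
Qed.

Lemma tube_exit A B x y : tube e A -> x \in A -> y \in A ->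
  x \in B -> y \notin B ->
  exists u v, [/\ u \in A, v \in A, e u v, u \in B & v \notin B].
Proof.
case/tubeP => _ conA xA yA Px nPy.
have [u [v [/andP[/andP[uA vA] euv] Pu nPv]]] :=
  connect_exit (P := fun u => u \in B) (conA _ _ xA yA) Px nPy.
by exists u, v.
Qed.

Lemma tubeU A B u v : tube e A -> tube e B -> u \in A -> v \in B ->
  (u == v) || e u v -> tube e (A :|: B).
Proof.
move=> /tubeP[_ cA] /tubeP[_ cB] uA vB uv; apply/tubeP; split.
  by apply/set0Pn; exists u; rewrite inE uA.
set r := [rel x y in A :|: B | e x y].
have rs : connect_sym r.
  by apply: sym_connect_sym => x y /=; rewrite e_sym [(x \in _) && _]andbC.
have cA' x : x \in A -> connect r x u.
  move=> xA; apply: connect_sub (cA _ _ xA uA) => a b /= /andP[/andP[aA bA] eab].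
  by apply: connect1; rewrite /= !inE aA bA.
have cB' x : x \in B -> connect r x u.
  move=> xB; apply: (connect_trans (y := v)).
    apply: connect_sub (cB _ _ xB vB) => a b /= /andP[/andP[aA bA] eab].
    by apply: connect1; rewrite /= !inE aA bA !orbT.
  case/orP: uv => [/eqP->//|uv]; rewrite rs; apply: connect1.
  by rewrite /= !inE uA vB orbT.
have c x : x \in A :|: B -> connect r x u by case/setUP; [apply: cA'|apply: cB'].
by move=> x y /c xu /c; rewrite rs; apply: connect_trans.
Qed.

Definition adjacent i A := [exists l in A, e l i].

Definition valley_tubes h : {set {set T}} :=
  [set A | tube e A & [forall i, forall j,
     [&& i \notin A, adjacent i A & j \in A] ==> (h i < h j)]].

Lemma valley_tubesP h A :
  reflect (tube e A /\ forall i j l, i \notin A -> l \in A -> e l i -> j \in A -> h i < h j)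
          (A \in valley_tubes h).
Proof.
rewrite inE; apply: (iffP andP) => -[tA H]; split=> //.
  move=> i j l iA lA eli jA; have /forallP/(_ i)/forallP/(_ j)/implyP := H; apply.
  by rewrite iA jA andbT; apply/existsP; exists l; rewrite lA.
apply/forallP=> i; apply/forallP => j; apply/implyP => /and3P[iA /existsP[l /andP[lA eli]] jA].
exact: (H i j l).
Qed.

Lemma valley_tubes_sub h h' : (forall i j, h i < h j -> h' i < h' j) ->
  valley_tubes h \subset valley_tubes h'.
Proof.
move=> hh'; apply/subsetP => A /valley_tubesP[tA H]; apply/valley_tubesP; split=> //.
by move=> i j l iA lA eli jA; apply/hh'/(H i j l).
Qed.

Lemma eq_valley_tubes h h' : (forall i j, (h i < h j) = (h' i < h' j)) ->
  valley_tubes h = valley_tubes h'.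
Proof.
move=> hh'; apply/eqP; rewrite eqEsubset !valley_tubes_sub // => i j; by rewrite hh'.
Qed.

(** If [A] and [B] were incompatible, connectedness would give a node of [A] outside [B] adjacent to
    [B], and a node of [B] outside [A] adjacent to [A]. Each would then have smaller rank than the
    other. *)
Lemma valley_tubes_tubing h : tube e setT -> tubing e (valley_tubes h).
Proof.
move=> tT; apply/and3P; split.
- by apply/valley_tubesP; split=> // i j l; rewrite inE.
- by apply/forall_inP => A /valley_tubesP[].
apply/forall_inP => A /valley_tubesP[tA HA]; apply/forall_inP => B /valley_tubesP[tB HB].
rewrite /compatible; apply/contraT; rewrite !negb_or negb_and negbK.
case/and3P => /subsetPn[a aA aB] /subsetPn[b bB bA] AB.
have [i [l [iA iB lB eli]]] : exists i l, [/\ i \in A, i \notin B, l \in B & e l i].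
  case/orP: AB => [|tAB].
    rewrite -setI_eq0 => /set0Pn[c /setIP[cA cB]].
    have [u [v [uA vA euv uB vB]]] := tube_exit tA cA aA cB aB.
    by exists v, u.
  have [disj|] := boolP [disjoint A & B]; last first.
    rewrite -setI_eq0 => /set0Pn[c /setIP[cA cB]].
    have [u [v [uA vA euv uB vB]]] := tube_exit tA cA aA cB aB.
    by exists v, u.
  have aAB : a \in A :|: B by rewrite inE aA.
  have bAB : b \in A :|: B by rewrite inE bB orbT.
  have [u [v [uAB vAB euv uB vB]]] := tube_exit tAB bAB aAB bB aB.
  by exists v, u; split=> //; move: vAB; rewrite inE (negbTE vB) orbF.
have [i' [l' [iB' iA' lA' eli']]] : exists i l, [/\ i \in B, i \notin A, l \in A & e l i].
  have [iaA|] := boolP (l \in A); last by exists l, i; split => //; rewrite e_sym.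
  have [u [v [uA vA euv uB vB]]] := tube_exit tB lB bB iaA bA.
  by exists v, u.
have := HB i i' l iB lB eli iB'; have := HA i' i l' iA' lA' eli' iA.
by move=> h1 h2; have := ltn_trans h1 h2; rewrite ltnn.
Qed.

Definition tubes_at U i := [set A in U | i \in A].

Lemma in_tubes_at U i A : (A \in tubes_at U i) = (A \in U) && (i \in A).
Proof. by rewrite inE. Qed.

(** The edge from [l] to [i] makes the union a tube, so compatibility leaves only nesting, and [i]
    decides its direction. *)
Lemma tubing_sub U A B i l : tubing e U -> A \in U -> B \in U ->
  i \notin A -> i \in B -> l \in A -> e l i -> A \subset B.
Proof.
case/and3P => _ tU /forall_inP cU AU BU iA iB lA eli.
have /forall_inP/(_ _ BU)/or3P[//|BA|/andP[_]] := cU _ AU.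
  by rewrite (subsetP BA) in iA.
by rewrite (tubeU (u := l) (v := i)) ?eli ?orbT // (forall_inP tU).
Qed.

(** By [tubing_sub], a neighbour of a tube [A] of [U] outside [A] lies in strictly fewer tubes than
    each node of [A], so [A] is a valley tube. Conversely a valley tube equals the smallest tube [B]
    of [U] containing it: otherwise some [j] in [A] lies only in tubes containing [B], and a
    neighbour of [A] within [B] cannot have smaller rank than [j]. *)
Lemma valley_tubes_compat U h : tubing e U ->
  (forall i j, tubes_at U i \subset tubes_at U j -> h i <= h j) ->
  (forall i j, tubes_at U i \proper tubes_at U j -> h i < h j) ->
  valley_tubes h = U.
Proof.
move=> tU hle hlt; have /and3P[TU /forall_inP tubeU_ /forall_inP compU] := tU.
apply/setP => A; apply/idP/idP => [/valley_tubesP[tA HA]|AU]; last first.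
  apply/valley_tubesP; split=> [|i j l iA lA eli jA]; first exact: tubeU_.
  apply: hlt; apply/properP; split; last by exists A; rewrite inE AU.
  apply/subsetP => B; rewrite !inE => /andP[BU iB]; rewrite BU /=.
  exact: (subsetP (tubing_sub tU AU BU iA iB lA eli)).
have [B /andP[BU AB] Bmin] : exists2 B, (B \in U) && (A \subset B) &
    forall C, C \in U -> A \subset C -> ~~ (C \proper B).
  pose P B := (B \in U) && (A \subset B).
  have TP : P setT by rewrite /P TU subsetT.
  case: (arg_minnP (fun B : {set T} => #|B|) TP) => B BP Bmin; exists B => // C CU AC.
  apply/negP => /proper_card; by rewrite ltnNge Bmin // /P CU.
have [-> //|neqAB] := eqVneq A B.
have /subsetPn[b bB bA] : ~~ (B \subset A).
  by apply: contra neqAB => BA; rewrite eqEsubset AB.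
have [A0 _] := tubeP _ tA; have [a aA] := set0Pn _ A0.
have [u [i [uB iB eui uA iA]]] := tube_exit (tubeU_ _ BU) (subsetP AB _ aA) bB aA bA.
suff [j jA jB] : exists2 j, j \in A & forall C, C \in U -> j \in C -> B \subset C.
  have : h j <= h i.
    apply: hle; apply/subsetP => C; rewrite !inE => /andP[CU jC]; rewrite CU /=.
    exact: (subsetP (jB _ CU jC)).
  by rewrite leqNgt (HA i j u).
have : [exists j in A, [forall C in U, (j \in C) ==> (B \subset C)]]; last first.
  case/exists_inP => j jA /forall_inP Hj; exists j => // C CU.
  by apply/implyP; apply: Hj.
apply/contraT; rewrite negb_exists_in => /forall_inP none_.
have {none_} none x : x \in A -> exists C, [/\ C \in U, x \in C & ~~ (B \subset C)].
  move/none_; rewrite negb_forall_in => /exists_inP[C CU].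
  by rewrite negb_imply => /andP[? ?]; exists C.
(* If there is no such [j], the tubes of [U] properly inside [B] cover [A]. A largest one meeting
   [A] does not contain [A], by minimality of [B]; the tube covering a node of [A] just outside it
   is larger, a contradiction. *)
pose P C := [&& C \in U, C \proper B & C :&: A != set0].
have [C0 PC0] : exists C, P C.
  have [C [CU aC BC]] := none _ aA; exists C.
  have /forall_inP/(_ _ BU)/or3P[CB|BC'|] := compU _ CU.
  - rewrite /P CU properE CB BC /=; apply/set0Pn; exists a; by rewrite inE aC.
  - by rewrite BC' in BC.
  by rewrite -setI_eq0 => /andP[/eqP/setP/(_ a)]; rewrite !inE aC (subsetP AB).
case: (arg_maxnP (fun B : {set T} => #|B|) PC0) => C /and3P[CU CB /set0Pn[c /setIP[cC cA]]] Cmax.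
have [a' a'A a'C] : exists2 a', a' \in A & a' \notin C.
  by apply/subsetPn; apply: contraL CB => /(Bmin _ CU).
have [v [w [vA wA evw vC wC]]] := tube_exit tA cA a'A cC a'C.
have [D [DU wD BD]] := none _ wA.
have CD := tubing_sub tU CU DU wC wD vC evw.
have : P D.
  rewrite /P DU; have /forall_inP/(_ _ BU)/or3P[DB|BD'|] := compU _ DU.
  - by rewrite properE DB BD /=; apply/set0Pn; exists w; rewrite inE wD.
  - by rewrite BD' in BD.
  by rewrite -setI_eq0 => /andP[/eqP/setP/(_ w)]; rewrite !inE wD (subsetP AB).
move/Cmax; rewrite /= leqNgt proper_card //; apply/properP; split=> //; by exists w.
Qed.

(** The witness is the connected component of [i] among the nodes of rank at least [h i]. *)
Lemma valley_tube_at h i :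
  exists2 A, A \in valley_tubes h & i \in A /\ {in A, forall j, h i <= h j}.
Proof.
pose r := [rel u v | [&& h i <= h u, h i <= h v & e u v]].
have rs : connect_sym r.
  by apply: sym_connect_sym => x y /=; rewrite e_sym andbCA.
pose A := [set j | connect r i j]; exists A; last first.
  split=> [|j]; rewrite inE ?connect0 // => /connectP[p].
  elim/last_ind: p => [|p k _] /=; first by move=> _ ->.
  by rewrite rcons_path last_rcons => /andP[_ /and3P[_ hk _]] ->.
have hA j : j \in A -> h i <= h j.
  rewrite inE => /connectP[p].
  elim/last_ind: p => [|p k _] /=; first by move=> _ ->.
  by rewrite rcons_path last_rcons => /andP[_ /and3P[_ hk _]] ->.
apply/valley_tubesP; split.
  apply/tubeP; split; first by apply/set0Pn; exists i; rewrite inE connect0.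
  suff cA x : x \in A -> connect [rel u v in A | e u v] i x.
    have rsA : connect_sym [rel u v in A | e u v].
      by apply: sym_connect_sym => x y /=; rewrite e_sym [(x \in _) && _]andbC.
    move=> x y /cA; rewrite rsA => xi /cA; exact: connect_trans.
  rewrite inE => /connectP[p]; elim/last_ind: p x => [|p k IH] x /=.
    by move=> _ ->; rewrite connect0.
  rewrite rcons_path last_rcons => /andP[pp rk] ->.
  have lA : connect r i (last i p) by apply/connectP; exists p.
  apply: connect_trans (IH _ pp erefl) _; apply: connect1.
  rewrite /= !inE lA; case/and3P: (rk) => _ _ ->; rewrite andbT /=.
  exact: connect_trans lA (connect1 rk).
move=> j k l jA lA elj kA /=; apply: leq_trans (hA _ kA); rewrite ltnNge.
apply: contra jA => hj; have hl := hA _ lA; move: lA; rewrite !inE => lA.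
apply: connect_trans lA (connect1 _).
by rewrite /= hj elj hl.
Qed.

Lemma leq_tubes_at h i j :
  tubes_at (valley_tubes h) i \subset tubes_at (valley_tubes h) j -> h i <= h j.
Proof.
have [A AU [iA HA]] := valley_tube_at h i.
by move=> /subsetP/(_ A); rewrite !in_tubes_at AU iA /= => /(_ isT)/HA.
Qed.

End Graph.

(** * Ordered trees and their gaps *)

Lemma tree_map_comp (A B C : Type) (f : A -> B) (g : B -> C) t :
  tree_map g (tree_map f t) = tree_map (g \o f) t.
Proof.
elim/tree_ind_all: t => //= a ts IH; congr Node; rewrite -map_comp.
by elim: ts IH => //= t ts IHts [-> /IHts ->].
Qed.

Lemma eq_tree_map (A B : Type) (f g : A -> B) : f =1 g -> tree_map f =1 tree_map g.
Proof.
move=> fg; elim/tree_ind_all=> //= a ts IH; rewrite fg; congr Node.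
by elim: ts IH => //= t ts IHts [-> /IHts ->].
Qed.

(** Both [s1] and [s2] are the longest prefix whose elements satisfy [p]. *)
Lemma cat_sep_inj (A : Type) (p : pred A) (s1 s2 l1 l2 : seq A) :
  all p s1 -> all p s2 -> ~~ (if l1 is x :: _ then p x else false) ->
  ~~ (if l2 is x :: _ then p x else false) ->
  s1 ++ l1 = s2 ++ l2 -> s1 = s2 /\ l1 = l2.
Proof.
elim: s1 s2 => [|x s1 IH] [|y s2] //=.
- by move=> _ /andP[py _] l1x _ E; rewrite E py in l1x.
- by move=> /andP[px _] _ _ l2x E; rewrite -E px in l2x.
case/andP=> _ ps1 /andP[_ ps2] nl1 nl2 [-> E].
by have [-> ->] := IH _ ps1 ps2 nl1 nl2 E.
Qed.

(* The root label is the least one, and its occurrences separate the gaps of  *)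
(* the children, so an ordered tree can be read off its gaps.                 *)
Lemma ordered_gaps_inj (A : eqType) (r : rel A) (t u : tree A) :
  (forall a b, r a b -> ~~ r b a) -> plane t -> plane u ->
  ordered r t -> ordered r u -> gaps t = gaps u -> t = u.
Proof.
move=> asym; have irr a : ~~ r a a by apply/negP => raa; have := asym _ _ raa; rewrite raa.
elim/tree_ind_all: t u => [|a ts IH] [|b us] //.
- move=> _ /andP[]; case: us => [|u [|v us]] // _ _ _ _; rewrite gaps_node.
  by move/(congr1 size); rewrite size_cat /= addnS.
- move=> /andP[]; case: ts {IH} => [|u [|v us']] // _ _ _ _ _; rewrite gaps_node.
  by move/(congr1 size); rewrite size_cat /= addnS.
case/andP=> szt plt /andP[szu plu] /andP[at_ ort] /andP[bu oru] E.
have gapsE c (vs : seq (tree A)) : 1 < size vs -> all (all (r c)) (map (@gaps A) vs) ->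
    (c \in gaps (Node c vs)) && all (fun x => (x == c) || r c x) (gaps (Node c vs)).
  move=> szv av; apply/andP; split.
    have := all_gaps_node (fun x => x != c) c szv; rewrite eqxx => /negbT.
    by rewrite -has_predC => /hasP[x xin /=]; rewrite negbK => /eqP xc; rewrite -{1}xc.
  rewrite all_gaps_node // eqxx; move: av; rewrite all_map.
  by apply: sub_all => v; apply: sub_all => x /= ->; rewrite orbT.
have ab : a = b.
  have /andP[a_in a_all] := gapsE _ _ szt at_; have /andP[b_in b_all] := gapsE _ _ szu bu.
  rewrite E in a_in a_all.
  have /orP[/eqP//|rba] := allP b_all _ a_in.
  have /orP[/eqP//|rab] := allP a_all _ b_in.
  by have := asym _ _ rab; rewrite rba.
subst b; congr Node.
have {E} : flatten [seq a :: gaps u | u <- ts] = flatten [seq a :: gaps u | u <- us].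
  by rewrite -!cons_gaps_node ?E // ltnW.
elim: ts us IH plt plu at_ bu ort oru {szt szu} => [|t ts IHts] [|u us] //=.
case=> IHt /IHts{}IHts /andP[pt pts] /andP[pu pus] /andP[at_ ats] /andP[au aus].
case/andP=> ot ots /andP[ou ous] [/(cat_sep_inj at_ au)[]].
- by case: (ts) => //= v vs; apply: irr.
- by case: (us) => //= v vs; apply: irr.
by move=> /(IHt _ pt pu ot ou) -> /(IHts _ pts pus ats aus ots ous) ->.
Qed.

(** * Building an ordered tree from the word of its gaps *)

Section Build.

Fixpoint split_at (m : nat) (s : seq nat) : seq (seq nat) :=
  if s is x :: s' then
    if x == m then [::] :: split_at m s'
    else (x :: head [::] (split_at m s')) :: behead (split_at m s')
  else [:: [::]].

Lemma split_at_neq0 m s : split_at m s != [::].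
Proof. by case: s => //= x s; case: ifP. Qed.

Lemma flatten_split_at m s : flatten [seq m :: x | x <- split_at m s] = m :: s.
Proof.
elim: s => //= x s; have := split_at_neq0 m s; case: (split_at m s) => // y ys _.
by case: eqP => [->|_] /= [->].
Qed.

Lemma size_split_at m s : m \in s -> 1 < size (split_at m s).
Proof.
elim: s => //= x s IH; rewrite inE eq_sym; case: eqP => [_ _|_ /= /IH].
  by have := split_at_neq0 m s; case: (split_at m s).
by case: (split_at m s) => //= ? [].
Qed.

Lemma split_atP m s p : p \in split_at m s -> {subset p <= s} /\ m \notin p.
Proof.
elim: s p => [|x s IH] p /=; first by rewrite inE => /eqP->.
have := split_at_neq0 m s; case: (split_at m s) IH => // y ys IH _.
case: eqP => [->|/eqP xm]; rewrite inE => /orP[/eqP->|].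
- by split.
- by move/IH => [sps mp]; split=> // z /sps; rewrite inE orbC => ->.
- have [sps mp] := IH y (mem_head _ _); split.
    by move=> z; rewrite !inE => /orP[->//|/sps ->]; rewrite orbT.
  by rewrite inE eq_sym negb_or xm.
move=> py; have [|sps mp] := IH p; first by rewrite inE py orbT.
by split=> // z /sps; rewrite inE orbC => ->.
Qed.

(** As there are at least two pieces, each is shorter than the word that was split; this keeps the
    fuel of [build] sufficient. *)
Lemma size_mem_flatten (A : eqType) (m : A) ss p : p \in ss ->
  size p + size ss <= size (flatten [seq m :: x | x <- ss]).
Proof.
have H qs : size qs <= size (flatten [seq m :: x | x <- qs]).
  by elim: qs => //= q qs IH; rewrite size_cat; lia.
elim: ss => //= q ss IH; rewrite inE size_cat => /orP[/eqP->|/IH]; last by lia.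
by have := H ss; lia.
Qed.

(** The Cartesian tree of the word [s], with all occurrences of the minimum merged into one node and
    empty pieces becoming leaves. [N] is fuel, sufficient once it is at least the length of [s]. *)
Fixpoint build N (s : seq nat) : tree nat :=
  if N is N'.+1 then
    if s is x :: s' then
      let m := foldr minn x s' in Node m (map (build N') (split_at m s))
    else Leaf
  else Leaf.

Lemma foldr_minn x s : foldr minn x s \in x :: s /\
  {in x :: s, forall y, foldr minn x s <= y}.
Proof.
elim: s => [|z s [IHin IH]] /=.
  by split=> [|y]; rewrite inE // => /eqP->.
split.
  have [_|_] := leqP z (foldr minn x s); first by rewrite !inE eqxx orbT.
  by move: IHin; rewrite !inE orbCA => ->; rewrite orbT.
move=> y; rewrite !inE orbCA => /orP[/eqP->|y_in]; first exact: geq_minl.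
by apply: leq_trans (IH y _); rewrite ?geq_minr // inE.
Qed.

Lemma buildP N s : size s <= N ->
  [/\ plane (build N s), ordered ltn (build N s) & gaps (build N s) = s].
Proof.
elim: N s => [|N IH] [|x s] //= szs.
set m := foldr minn x s; have [m_in m_min] := foldr_minn x s.
set ps := if _ then _ else _; have Eps : ps = split_at m (x :: s) by [].
clearbody ps.
have psN p : p \in ps -> size p <= N.
  rewrite Eps => /(size_mem_flatten m); rewrite -Eps Eps flatten_split_at -Eps /= => szp.
  by have := size_split_at m_in; rewrite -Eps; lia.
have gE : map (@gaps nat) (map (build N) ps) = ps.
  rewrite -map_comp -[RHS]map_id; apply/eq_in_map => p pin /=.
  by have [] := IH p (psN _ pin).
split.
- rewrite size_map {1}Eps size_split_at //= all_map; apply/allP => p pin /=.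
  by have [] := IH p (psN _ pin).
- rewrite gE all_map; apply/andP; split; apply/allP; last first.
    by move=> p pin /=; have [] := IH p (psN _ pin).
  move=> p; rewrite Eps => /split_atP[sub mp]; apply/allP => y yp /=.
  rewrite ltn_neqAle m_min ?sub // andbT; apply: contraNneq mp => ->; exact: yp.
by rewrite gE Eps flatten_split_at.
Qed.

End Build.

(** * Intervals of gaps above the nodes of a tree *)

Section Extents.

Variable A : Type.
Implicit Types (t : tree A) (ts : seq (tree A)).

(* Pairs each label with the half-open interval of the indices of the gaps    *)
(* ending at or above the node, the gaps of [t] being numbered from [k].      *)
Fixpoint extents k t : tree (nat * nat * A) :=
  if t is Node a ts then
    Node (k, k + size (gaps t), a)
      ((fix loop k ts := if ts is t :: ts' then
          extents k t :: loop (k + size (gaps t)).+1 ts' else [::]) k ts)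
  else Leaf.

(** A name for the local fixpoint inside [extents], convertible with it. *)
Fixpoint extents_seq k ts : seq (tree (nat * nat * A)) :=
  if ts is t :: ts' then extents k t :: extents_seq (k + size (gaps t)).+1 ts'
  else [::].

Lemma extents_node k a ts : extents k (Node a ts) =
  Node (k, k + size (gaps (Node a ts)), a) (extents_seq k ts).
Proof. by []. Qed.

Lemma map_extents k t : tree_map snd (extents k t) = t.
Proof.
elim/tree_ind_all: t k => // a ts IH k; rewrite extents_node /=; congr Node.
by elim: ts k IH => //= t ts IHts k [-> /IHts ->].
Qed.

Lemma size_extents k t : size (gaps (extents k t)) = size (gaps t).
Proof. by rewrite -{2}(map_extents k t) gaps_map size_map. Qed.

Lemma plane_extents k t : plane (extents k t) = plane t.
Proof. by rewrite -{2}(map_extents k t) plane_map. Qed.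

Lemma size_flatten_extents (x : nat * nat * A) (a : A) k ts :
  size (flatten [seq x :: gaps u | u <- extents_seq k ts]) =
  size (flatten [seq a :: gaps u | u <- ts]).
Proof. by elim: ts k => //= t ts IH k; rewrite !size_cat size_extents IH. Qed.

(** [I] is the largest half-open interval around [p], within the window of length [n] from [k], on
    which [H] is at least [H p]. *)
Definition extent_spec (H : nat -> nat) k n p (I : nat * nat) : Prop :=
  [/\ k <= I.1 <= p, p < I.2 <= k + n,
      forall l, I.1 <= l < I.2 -> H p <= H l,
      k < I.1 -> H I.1.-1 < H p & I.2 < k + n -> H I.2 < H p].

(** The gaps ending at or above a node form a contiguous run with values at least that of the node.
    A gap bordering this run ends at a node strictly below, whose value is smaller. *)
Lemma extentP (H : nat -> nat) (w : A -> nat) t k a0 x0 :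
  plane t -> ordered (fun a b => w a < w b) t ->
  (forall p, p < size (gaps t) -> H (k + p) = w (nth a0 (gaps t) p)) ->
  forall p, p < size (gaps t) ->
    extent_spec H k (size (gaps t)) (k + p) (nth x0 (gaps (extents k t)) p).1.
Proof.
elim/tree_ind_all: t k => // a ts IH k /andP[szt plt] /andP[at_ ort] HH p plt'.
have {szt} ts0 : 0 < size ts by apply: ltnW.
set K := k in HH *; set n := size (gaps (Node a ts)) in HH plt' *.
have Kle l : K <= l < K + n -> w a <= H l.
  move=> /andP[Kl lKn]; rewrite -(subnKC Kl) HH; last by lia.
  have : all (fun b => w a <= w b) (gaps (Node a ts)).
    have := cons_gaps_node a ts0 => /(congr1 (all (fun b => w a <= w b))).
    rewrite /= leqnn /= -/(gaps (Node a ts)) => ->.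
    rewrite all_flatten_map; move: at_; rewrite all_map; apply: sub_all => t /=.
    by rewrite leqnn; apply: sub_all => x; apply: ltnW.
  by move/(all_nthP a0); apply; rewrite -/n; lia.
rewrite extents_node -/K -/n.
set X := (K, K + n, a).
have root q : K <= q < K + n -> H q = w a -> extent_spec H K n q X.1.
  move=> Kq Hq; split=> //=; try lia.
  by move=> l Kl; rewrite Hq Kle.
have En : (flatten [seq a :: gaps u | u <- ts]) = a :: gaps (Node a ts).
  by rewrite cons_gaps_node.
have sz_ext : 0 < size (extents_seq K ts) by case: (ts) ts0.
have EnX : (flatten [seq X :: gaps u | u <- extents_seq K ts]) =
    X :: gaps (Node X (extents_seq K ts)) by rewrite cons_gaps_node.
rewrite -[nth _ _ _]/(nth x0 (X :: _) p.+1) -EnX.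
rewrite -(leq_add2l K) in plt'.
have En1 q : q.+1 < size (flatten [seq a :: gaps u | u <- ts]) ->
    H (K + q) = w (nth a0 (flatten [seq a :: gaps u | u <- ts]) q.+1).
  by rewrite En => ltq; rewrite HH.
have {plt'} ltp : p.+1 < size (flatten [seq a :: gaps u | u <- ts]).
  by rewrite En /= -/n; lia.
have sz : K + size (flatten [seq a :: gaps u | u <- ts]) = (K + n).+1.
  by rewrite En /= -/n; lia.
have HK : K < K -> H K.-1 = w a by rewrite ltnn.
(* Induction over the remaining children: [j] is the first gap index of the current child, and past
   the first child [j.-1] is a gap ending at the root, with the least value [w a]. Positions are
   shifted by one because the list starts with the separator before that child. *)
suff main j : K <= j -> j + size (flatten [seq a :: gaps u | u <- ts]) = (K + n).+1 ->
    (K < j -> H j.-1 = w a) ->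
    (forall q, q.+1 < size (flatten [seq a :: gaps u | u <- ts]) ->
       H (j + q) = w (nth a0 (flatten [seq a :: gaps u | u <- ts]) q.+1)) ->
    forall q, q.+1 < size (flatten [seq a :: gaps u | u <- ts]) ->
      extent_spec H K n (j + q)
        (nth x0 (flatten [seq X :: gaps u | u <- extents_seq j ts]) q.+1).1.
  by apply: main => //; rewrite ltnn.
clear ts0 En sz_ext EnX HH En1 ltp sz p; clearbody n.
elim: ts j IH plt at_ ort => //= t ts IHts j [IHt {}/IHts IHts].
case/andP=> pt /IHts{}IHts /andP[at_ /IHts{}IHts] /andP[ot /IHts{}IHts].
move=> Kj; rewrite size_cat => szE Hj HH q ltq.
set Fl := flatten _ in szE HH ltq; set FX := flatten _.
have szF : size FX = size Fl by apply: size_flatten_extents.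
have HF r : r < size Fl -> H (j + size (gaps t) + r) = w (nth a0 Fl r).
  move=> ltr; rewrite -addnA HH; last by lia.
  by rewrite nth_cat ltnNge leq_addr addKn.
have HF0 : 0 < size Fl -> H (j + size (gaps t)) = w a.
  move=> Fl0; rewrite -[j + _]addn0 HF //.
  by move: Fl0; rewrite /Fl; case: (ts).
rewrite nth_cat size_extents; case: ltnP => [q_lt|q_ge].
  have := IHt j pt ot _ q q_lt; case=> [r r_lt|].
    by rewrite HH ?nth_cat ?r_lt //; lia.
  case: (nth _ _ _) => -[lo hi] b /=.
  move=> /andP[jlo lop] /andP[phi hij] Hmin Hlo Hhi.
  have aHq : w a < H (j + q).
    rewrite HH; last by lia.
    by rewrite nth_cat q_lt; apply: (all_nthP a0 at_).
  split=> //=; try lia.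
    move=> Klo; move: jlo; rewrite leq_eqVlt => /orP[/eqP jlo|/Hlo//].
    by rewrite -jlo Hj //; lia.
  move=> hiK; move: hij; rewrite leq_eqVlt => /orP[/eqP hij|/Hhi//].
  by rewrite hij HF0 //; lia.
have [r Eq] : exists r, q = size (gaps t) + r by exists (q - size (gaps t)); lia.
rewrite Eq addKn addnA; have ltr : r < size Fl by lia.
case: r Eq ltr => [|r] Eq ltr.
  rewrite addn0 [nth _ _ _](_ : _ = X); last first.
    by move: ltr; rewrite -szF /FX; case: (ts).
  by apply: root; [lia|apply: HF0].
rewrite addnS -addSn; apply: IHts; rewrite -/Fl //; try lia.
  by move=> _; apply: HF0; lia.
by move=> r' ltr'; rewrite addSn -addnS HF.
Qed.

End Extents.

(** * Refinement of level sets *)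

Lemma filter_ltn_iota (c : nat -> nat) M s : sorted leq (map c s) ->
  [seq l <- s | c l < M] ++ [seq l <- s | c l == M] = [seq l <- s | c l < M.+1].
Proof.
elim: s => //= l s IH srt; have := IH (path_sorted srt); rewrite ltnS.
case: ltngtP => /= [_ <-//|lt_Ml _|cM _].
  have cs : all (fun l => M < c l) s.
    have /allP := order_path_min leq_trans srt => H; apply/allP => x xs.
    by apply: leq_trans lt_Ml _; apply: H; apply: map_f.
  rewrite (eq_in_filter (a2 := pred0)) ?filter_pred0; last first.
    by move=> x /(allP cs) /=; lia.
  rewrite (eq_in_filter (a2 := pred0)) ?filter_pred0; last first.
    by move=> x /(allP cs) /=; lia.
  rewrite (eq_in_filter (a2 := pred0)) ?filter_pred0 //.
  by move=> x /(allP cs) /=; lia.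
have cs : all (fun l => M <= c l) s.
  have /allP := order_path_min leq_trans srt => H; apply/allP => x xs.
  by rewrite -cM; apply: H; apply: map_f.
rewrite (eq_in_filter (a2 := pred0)) ?filter_pred0 /=; last first.
  by move=> x /(allP cs) /=; lia.
by congr (_ :: _); apply: eq_in_filter => x /(allP cs) /=; lia.
Qed.

Lemma flatten_filter_iota (c : nat -> nat) M s : sorted leq (map c s) ->
  flatten [seq [seq l <- s | c l == k] | k <- iota 0 M] = [seq l <- s | c l < M].
Proof.
move=> srt; elim: M => [|M IH]; first by rewrite filter_pred0.
by rewrite -addn1 iotaD map_cat flatten_cat IH /= cats0 filter_ltn_iota // addn1.
Qed.

Section LevelSets.

Variable T : finType.
Implicit Types (g h : T -> nat).

Definition level_sets N h : seq {set T} := [seq [set i | h i == k] | k <- iota 0 N].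

Definition onto_levels N h := (forall i, h i < N) /\ (forall k, k < N -> exists i, h i = k).

(** Position in the list of level sets is the rank itself, so a refinement keeps blocks in order;
    conversely the [g]-levels grouped by their [h]-value give the required lists of blocks. *)
Lemma refines_level_setsP M N h g : onto_levels M h -> onto_levels N g ->
  refines (level_sets N g) (level_sets M h) <-> (forall i j, h i < h j -> g i < g j).
Proof.
move=> [hM honto] [gN gonto]; split=> [[ss E parts] i j hij|mono].
  have inss x : [set y | g y == g x] \in nth [::] ss (h x).
    move: parts; rewrite all2E size_map size_iota => /andP[/eqP sz].
    move/(all_nthP (set0, [::]))/(_ (h x)).
    rewrite size_zip size_map size_iota -sz minnn hM => /(_ isT).
    rewrite nth_zip ?size_map ?size_iota //= (nth_map 0) ?size_iota // nth_iota //.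
    case/andP=> _ /andP[/eqP cov _].
    have : x \in cover [set:: nth [::] ss (h x)] by rewrite cov inE.
    case/bigcupP=> C; rewrite inE => C_in xC.
    have : C \in level_sets N g.
      rewrite E; apply/flattenP; exists (nth [::] ss (h x)) => //.
      by apply: mem_nth; rewrite -sz.
    case/mapP => k _ EC; move: xC; rewrite EC inE => /eqP Ek.
    by rewrite Ek -EC.
  (* [p] counts the [g]-levels coming from [h]-blocks before that of [j]; it separates [g i] from
     [g j]. *)
  pose b := h j; pose p := size (flatten (take b ss)).
  have Ep : flatten ss = flatten (take b ss) ++ flatten (drop b ss).
    by rewrite -flatten_cat cat_take_drop.
  have lvl_inj k x : [set y | g y == k] = [set y | g y == g x] -> g x = k.
    by move/setP/(_ x); rewrite !inE eqxx => /eqP.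
  have bss : b < size ss.
    by move: parts; rewrite all2E size_map size_iota => /andP[/eqP <- _]; apply: hM.
  apply: (@leq_trans p).
    have : [set y | g y == g i] \in take p (level_sets N g).
      rewrite E Ep take_size_cat //; apply/flattenP; exists (nth [::] ss (h i)) => //.
      by rewrite -(nth_take _ hij); apply: mem_nth; rewrite size_take bss.
    rewrite -map_take => /mapP[k k_in /esym/lvl_inj->].
    by move: k_in; rewrite take_iota mem_iota; lia.
  have : [set y | g y == g j] \in drop p (level_sets N g).
    rewrite E Ep drop_size_cat //; apply/flattenP; exists (nth [::] ss (h j)) => //.
    rewrite -[h j]addn0 -nth_drop; apply: mem_nth; by rewrite size_drop subn_gt0.
  rewrite -map_drop => /mapP[k k_in /esym/lvl_inj->].
  by move: k_in; rewrite drop_iota mem_iota; lia.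
(* The [h]-value of a whole [g]-level; it is well defined because nodes with different [h]-values
   have different [g]-values. *)
pose c l := if [pick i | g i == l] is Some i then h i else 0.
have cg i : c (g i) = h i.
  rewrite /c; case: pickP => [j /eqP gji|/(_ i)]; last by rewrite eqxx.
  case: (ltngtP (h j) (h i)) => // /mono; rewrite gji ltnn //.
pose ss := [seq [seq [set i | g i == l] | l <- iota 0 N & c l == k] | k <- iota 0 M].
exists ss.
  have -> : ss = map (map (fun l => [set i | g i == l]))
      [seq [seq l <- iota 0 N | c l == k] | k <- iota 0 M] by rewrite -map_comp.
  rewrite -map_flatten flatten_filter_iota.
    rewrite (eq_in_filter (a2 := predT)) ?filter_predT // => l.
    by rewrite mem_iota => /andP[_ /gonto[i <-]]; rewrite cg hM.
  apply: (homo_sorted_in (P := fun l => l < N) (e := leq)); last exact: iota_sorted.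
    move=> l l' /gonto[i <-] /gonto[i' <-]; rewrite !cg leqNgt => gii.
    by rewrite leqNgt; apply: contra gii => /mono.
  by apply/allP => l; rewrite mem_iota.
rewrite all2E !size_map eqxx /= zip_map all_map; apply/allP => k; rewrite mem_iota => /andP[_ kM] /=.
have lvl_inj : {in gtn N &, injective (fun l => [set i | g i == l])}.
  move=> l l' /gonto[i <-] _ /setP/(_ i); by rewrite !inE eqxx => /esym/eqP.
apply/andP; split.
  rewrite map_inj_in_uniq ?filter_uniq ?iota_uniq // => l l'.
  rewrite !mem_filter !mem_iota => /andP[_ /andP[_ lN]] /andP[_ /andP[_ l'N]].
  exact: lvl_inj.
apply/and3P; split.
- apply/eqP/setP => i; rewrite inE; apply/bigcupP/eqP => [[C]|hi].
    rewrite inE => /mapP[l]; rewrite mem_filter => /andP[/eqP <- _] ->.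
    by rewrite inE => /eqP <-.
  exists [set j | g j == g i]; last by rewrite inE.
  rewrite inE; apply: map_f; by rewrite mem_filter cg hi eqxx mem_iota gN.
- apply/trivIsetP => B C; rewrite !inE => /mapP[l _ ->] /mapP[l' _ ->] ll'.
  rewrite -setI_eq0; apply/eqP/setP => i; rewrite !inE.
  by apply/andP => -[/eqP gl /eqP gl']; rewrite -gl -gl' eqxx in ll'.
rewrite inE; apply/mapP => -[l]; rewrite mem_filter mem_iota => /andP[_ /andP[_ /gonto[i <-]]].
by move/setP/(_ i); rewrite !inE eqxx.
Qed.

(** The number of values of [h] below [h i]: the ranking with the same order and no skipped
    value. *)
Definition squash h i := count (fun k => [exists j, h j == k]) (iota 0 (h i)).

Lemma squash_lt h i j : (squash h i < squash h j) = (h i < h j).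
Proof.
pose S v := count (fun k => [exists j, h j == k]) (iota 0 v).
have mono a b : a <= b -> S a <= S b.
  by move=> ab; rewrite /S -(subnKC ab) iotaD count_cat leq_addr.
rewrite -[squash h i]/(S (h i)) -[squash h j]/(S (h j)).
apply/idP/idP; first by rewrite !ltnNge; apply: contra; apply: mono.
move=> ij; apply: leq_trans (mono _ _ ij).
rewrite /S -(addn1 (h i)) iotaD count_cat /= add0n addn0.
by case: existsP => [_|[]]; [rewrite addn1|exists i].
Qed.

Lemma squash_onto h i k : k < squash h i -> exists j, squash h j = k.
Proof.
rewrite /squash; elim: (h i) => // v IH; rewrite -(addn1 v) iotaD count_cat /= add0n addn0.
case: (ltnP k (count (fun k => [exists j, h j == k]) (iota 0 v))) => [/IH//|kv].
case: existsP => [[j /eqP hj] k_lt|_]; last by rewrite addn0 ltnNge kv.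
by exists j; rewrite hj; apply/eqP; rewrite eqn_leq kv; rewrite addn1 in k_lt.
Qed.

End LevelSets.

Definition down_closed (s : seq nat) := forall k l, k \in s -> l < k -> l \in s.

Lemma down_closedP s :
  reflect (down_closed s) (all (fun k => all (mem s) (iota 0 k)) s).
Proof.
apply: (iffP allP) => [H k l /H/allP Hk lk|H k ks].
  by apply: Hk; rewrite mem_iota.
by apply/allP => l; rewrite mem_iota => /andP[_]; apply: H.
Qed.

Lemma mem_down_closed s k : down_closed s -> (k \in s) = (k < size (undup s)).
Proof.
move=> dc; apply/idP/idP => [ks|].
  rewrite -[k.+1](size_iota 0); apply: uniq_leq_size; first exact: iota_uniq.
  move=> l; rewrite mem_iota mem_undup /= add0n ltnS leq_eqVlt => /orP[/eqP->//|].
  exact: dc.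
apply: contraLR => ks; rewrite -leqNgt -[X in _ <= X](size_iota 0).
apply: uniq_leq_size (undup_uniq _) _ => l; rewrite mem_undup mem_iota => ls /=.
by rewrite add0n ltnNge leq_eqVlt; apply: contra ks => /orP[/eqP->|/(dc _ _ ls)].
Qed.

(** * Rankings and [W] *)

Section OrderedTheory.

Variable A : Type.
Implicit Types (t : tree A) (r : rel A).

Lemma ordered_and r1 r2 t :
  ordered (fun a b => r1 a b && r2 a b) t = ordered r1 t && ordered r2 t.
Proof.
elim/tree_ind_all: t => //= a ts IH; rewrite !all_map andbACA; congr andb.
  rewrite -all_predI; apply: eq_all => t /=; exact: all_predI.
elim: ts IH => //= t ts IHts [-> /IHts ->]; exact: andbACA.
Qed.

Lemma eq_in_ordered (p : pred A) r1 r2 t : plane t -> all p (gaps t) ->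
  (forall a b, p a -> p b -> r1 a b = r2 a b) -> ordered r1 t = ordered r2 t.
Proof.
move=> plt pt r12; elim/tree_ind_all: t plt pt => // a ts IH /andP[szt plt].
rewrite all_gaps_node // => /andP[pa pts] /=; congr andb.
  rewrite !all_map; elim: ts pts {IH szt plt} => //= t ts IHts /andP[pt /IHts ->].
  congr andb; elim: (gaps t) pt => //= b s IHs /andP[pb /IHs ->].
  by rewrite r12.
elim: ts IH plt pts {szt} => //= t ts IHts [IHt /IHts{}IHts] /andP[plt /IHts{}IHts].
by case/andP=> /(IHt plt) -> /IHts ->.
Qed.

Lemma mem_levels (lev : A -> option nat) k t : plane t ->
  (k \in levels lev t) = has (fun a => lev a == Some k) (gaps t).
Proof.
move=> plt; have := all_labels (fun a => lev a != Some k) plt.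
rewrite -[has _ _]negbK -all_predC => <-; rewrite -[RHS]/(~~ all _ _) /levels.
elim: (labels t) => //= a s IH.
case: (lev a) => [l|] //=; rewrite inE IH negb_and negbK; congr (_ || _).
by rewrite eq_sym.
Qed.

End OrderedTheory.

Section Ranks.

Variable m : nat.

Definition rank_label (a : paint nat nat) : nat :=
  match a with
  | Painted k => k
  | HalfPainted => m
  | Unpainted k => m.+1 + k
  end.

Definition unrank k : paint nat nat :=
  if k < m then Painted _ k else if k == m then HalfPainted else Unpainted (k - m.+1).

Lemma unrankK k : rank_label (unrank k) = k.
Proof. by rewrite /unrank; case: ltngtP => //= mk; rewrite -?addSnnS subnKC. Qed.

Lemma painted_unrank k l : (painted (unrank k) == Some l) = (k == l) && (l < m).
Proof.
rewrite /unrank; case: ltngtP => //= km.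
- by rewrite (inj_eq (@Some_inj _)); case: eqP => // <-; rewrite km.
- by apply/idP/idP => // /andP[/eqP]; lia.
- by apply/idP/idP => // /andP[/eqP]; lia.
Qed.

Lemma unpainted_unrank k l : (unpainted (unrank k) == Some l) = (k == m.+1 + l).
Proof.
rewrite /unrank; case: ltngtP => //= km.
- by apply/idP/eqP => //; lia.
- by rewrite (inj_eq (@Some_inj _)); lia.
- by apply/idP/eqP => //; lia.
Qed.

End Ranks.

Definition painted_below m (a : paint nat nat) := oapp (gtn m) true (painted a).

(** With painted labels ranked below [m], half-painted ones at [m] and unpainted ones above, an
    increase of rank says at once that the painting rule and both weak orders hold. Every painted
    level is below [m] because the levels are consecutive. *)
Lemma is_WP n (t : tree (paint nat nat)) (m := n_levels (@painted _ _) t) :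
  reflect [/\ plane t, size (gaps t) = n, down_closed (levels (@painted _ _) t),
     down_closed (levels (@unpainted _ _) t) &
     ordered (fun a b => rank_label m a < rank_label m b) t] (is_W n t).
Proof.
have ordE : plane t -> down_closed (levels (@painted _ _) t) ->
  ordered (fun a b => rank_label m a < rank_label m b) t =
  [&& ordered (fun a b => ~~ isSome (painted a) ==> isSome (unpainted b)) t,
      ordered (fun a b => if (painted a, painted b) is (Some k, Some l) then k < l else true) t
    & ordered (fun a b => if (unpainted a, unpainted b) is (Some k, Some l) then k < l else true) t].
  move=> plt dc; rewrite -!ordered_and.
  apply: (@eq_in_ordered _ (painted_below m)) => //.
    rewrite -[all _ _]negbK -has_predC; apply/negP => /(has_nthP HalfPainted)[i lti /=].
    case E: (nth _ _ i) => [k||k] //=; rewrite /painted_below /= -mem_down_closed //.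
    rewrite mem_levels //; case/negP; apply/(has_nthP HalfPainted); exists i => //.
    by rewrite E.
  rewrite /painted_below; move=> [k||k] [l||l] //=; rewrite ?andbT; lia.
rewrite /is_W /painted_tree /weak_order.
apply: (iffP and4P) => [[/andP[plt] abv /eqP szt /andP[dcp op] /andP[dcu ou]]|].
  move: abv op ou dcp dcu; rewrite !all_aboveE // => abv op ou /down_closedP dcp /down_closedP dcu.
  split=> //; last by rewrite ordE // abv op ou.
  by move: szt; rewrite size_leaves // => -[].
case=> plt szt dcp dcu; rewrite ordE // => /and3P[abv op ou].
have [/down_closedP-> /down_closedP->] := (dcp, dcu).
by rewrite !all_aboveE // size_leaves // szt; split; rewrite ?plt.
Qed.

Section W.

Variable n : nat.
Implicit Types t s : W n.

Definition n_painted t := n_levels (@painted _ _) (val t).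

(** The graph node 0 gets the rank of the half-painted nodes, following its place in the growth
    partition; gap [i > 0] sits at position [i - 1] of [gaps]. *)
Definition gap_rank t (i : nat) : nat :=
  if i is p.+1 then rank_label (n_painted t) (nth HalfPainted (gaps (val t)) p)
  else n_painted t.

Definition rank t (i : 'I_n.+1) : nat := gap_rank t i.

Lemma gap_rankS t i : 0 < i ->
  gap_rank t i = rank_label (n_painted t) (nth HalfPainted (gaps (val t)) i.-1).
Proof. by case: i. Qed.

Lemma W_plane t : plane (val t). Proof. by case/is_WP: (valP t). Qed.

Lemma W_size t : size (gaps (val t)) = n. Proof. by case/is_WP: (valP t). Qed.

Lemma W_ordered t :
  ordered (fun a b => rank_label (n_painted t) a < rank_label (n_painted t) b) (val t).
Proof. by case/is_WP: (valP t). Qed.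

Lemma mem_painted t k :
  has (fun a => painted a == Some k) (gaps (val t)) = (k < n_painted t).
Proof.
by have [plt _ dc _ _] := is_WP _ _ (valP t); rewrite -mem_levels // mem_down_closed.
Qed.

Lemma mem_unpainted t k :
  has (fun a => unpainted a == Some k) (gaps (val t)) =
  (k < n_levels (@unpainted _ _) (val t)).
Proof.
by have [plt _ _ dc _] := is_WP _ _ (valP t); rewrite -mem_levels // mem_down_closed.
Qed.

Lemma painted_lt t p k : p < n ->
  nth HalfPainted (gaps (val t)) p = Painted _ k -> k < n_painted t.
Proof.
move=> ltp E; rewrite -mem_painted; apply/(has_nthP HalfPainted).
by exists p; rewrite ?W_size // E.
Qed.

Definition n_blocks t := n_painted t + (n_levels (@unpainted _ _) (val t)).+1.

Lemma rank_onto t : onto_levels (n_blocks t) (rank t).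
Proof.
split=> [[[|p] ltp]|k]; rewrite /rank /gap_rank /=.
- by rewrite /n_blocks addnS ltnS leq_addr.
- case E: (nth _ _ p) => [k||k] /=; rewrite /n_blocks ?addSnnS; try lia.
    by have := painted_lt ltp E; lia.
  rewrite ltn_add2l ltnS -mem_unpainted; apply/(has_nthP HalfPainted).
  by exists p; rewrite ?W_size // E.
(* The middle value is attained by 0 even if no node is half-painted. *)
rewrite /n_blocks => ltk; case: (ltngtP k (n_painted t)) => [kp|kp|->]; last by exists ord0.
  move: (kp); rewrite -mem_painted => /(has_nthP HalfPainted)[p ltp].
  rewrite W_size in ltp; case E: (nth _ _ p) => [l||l] //= /eqP[<-].
  by exists (Ordinal (ltp : p.+1 < n.+1)); rewrite /= E.
have : k - (n_painted t).+1 < n_levels (@unpainted _ _) (val t) by lia.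
rewrite -mem_unpainted => /(has_nthP HalfPainted)[p ltp].
rewrite W_size in ltp; case E: (nth _ _ p) => [l||l] //= /eqP[El].
by exists (Ordinal (ltp : p.+1 < n.+1)); rewrite /= E /= El; lia.
Qed.

Lemma growth_partitionE t : growth_partition t = level_sets (n_blocks t) (rank t).
Proof.
have endsE (i : 'I_n.+1) : 0 < i -> label (val t) (gap_end (val t) i) =
    Some (nth HalfPainted (gaps (val t)) i.-1).
  case: i => -[|p] //= ltp _; rewrite label_gap_end ?W_plane ?W_size //.
  by rewrite (nth_map HalfPainted) // W_size.
rewrite /growth_partition /level_sets /n_blocks iotaD map_cat add0n.
congr (_ ++ _).
  apply/eq_in_map => k; rewrite mem_iota => /andP[_ ltk]; apply/setP => i; rewrite !inE.
  rewrite /rank; case: (posnP i) => [->|i0] /=; first by symmetry; apply/negP; rewrite /n_painted; lia.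
  rewrite endsE //= gap_rankS //.
  case: (nth _ _ _) => [l||l] /=; first by rewrite (inj_eq (@Some_inj _)).
  - by apply/idP/eqP => //; rewrite /n_painted; lia.
  - by apply/idP/eqP => //; rewrite /n_painted; lia.
rewrite -[iota _ _.+1]/(_ :: iota _.+1 _) map_cons; congr (_ :: _).
  apply/setP => i; rewrite !inE -val_eqE /= /rank.
  case: (posnP i) => [->|i0] /=; first by rewrite eqxx.
  rewrite endsE //= gap_rankS // ?(gtn_eqF i0) /=.
  case E: (nth _ _ _) => [l||l] /=.
  - have := @painted_lt t i.-1 l _ E; rewrite prednK // -ltnS => /(_ (ltn_ord i)).
    by rewrite /n_painted; lia.
  - by rewrite eqxx.
  - by rewrite /n_painted; lia.
have -> N : iota (n_painted t).+1 N = map (addn (n_painted t).+1) (iota 0 N).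
  by rewrite -iotaDl addn0.
rewrite -map_comp.
apply: eq_map => k; apply/setP => i; rewrite !inE /= /rank.
case: (posnP i) => [->|i0] /=; first by symmetry; apply/negP; rewrite /n_painted; lia.
rewrite endsE //= gap_rankS //.
case E: (nth _ _ _) => [l||l] /=.
- have := @painted_lt t i.-1 l _ E; rewrite prednK // -ltnS => /(_ (ltn_ord i)).
  by move=> lm; apply/idP/eqP => //; rewrite /n_painted in lm *; lia.
- by apply/idP/eqP => //; rewrite /n_painted; lia.
- by rewrite (inj_eq (@Some_inj _)) /n_painted; lia.
Qed.

Lemma refines_rankP t s : refines (growth_partition s) (growth_partition t) <->
  (forall i j, rank t i < rank t j -> rank s i < rank s j).
Proof.
by rewrite !growth_partitionE; apply: refines_level_setsP; apply: rank_onto.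
Qed.

End W.

(** * The fan graph and the forgetful map *)

Definition between (l i j : nat) := (i <= l <= j) || (j <= l <= i).

Section ForgetRank.

Variable n : nat.
Implicit Types t s : W n.

(** Gaps are numbered from 1, so the interval consists of nodes of the fan. *)
Definition extent (A : Type) (t : tree A) (i : nat) : nat * nat :=
  nth (0, 0) (map fst (gaps (extents 1 t))) i.-1.

Lemma extents_tree_map (A B : Type) (f : A -> B) k (t : tree A) :
  tree_map fst (extents k (tree_map f t)) = tree_map fst (extents k t).
Proof.
elim/tree_ind_all: t k => // a ts IH k.
rewrite [tree_map f _]/= !extents_node; congr Node.
  by rewrite -[Node (f a) _]/(tree_map f (Node a ts)) gaps_map size_map.
elim: ts k IH => //= t ts IHts k [IHt /IHts IH].
by rewrite gaps_map size_map; congr (_ :: _); [exact: IHt | exact: IH].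
Qed.

Lemma extent_map (A B : Type) (f : A -> B) (t : tree A) i :
  extent (tree_map f t) i = extent t i.
Proof. by rewrite /extent -!gaps_map extents_tree_map. Qed.

Lemma extent_rank_spec t i : 0 < i -> i < n.+1 ->
  extent_spec (gap_rank t) 1 n i (extent (val t) i).
Proof.
move=> i0 lti; have ltp : i.-1 < size (gaps (val t)) by rewrite W_size -ltnS prednK.
have := @extentP _ (gap_rank t) (rank_label (n_painted t)) (val t) 1 HalfPainted
  (0, 0, HalfPainted) (W_plane t) (W_ordered t) (fun _ _ => erefl) _ ltp.
rewrite W_size add1n prednK // /extent (nth_map (0, 0, HalfPainted)) //.
by rewrite size_extents.
Qed.

Lemma extent_bounds t i : 0 < i -> i < n.+1 ->
  (0 < (extent (val t) i).1 <= i) && (i < (extent (val t) i).2 <= n.+1).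
Proof. by move=> i0 /(extent_rank_spec t i0)[-> ->]. Qed.

Lemma rank_extentP t (i j : 'I_n.+1) : 0 < i -> 0 < j ->
  reflect (forall l : 'I_n.+1, between l i j -> rank t i <= rank t l)
          ((extent (val t) i).1 <= j < (extent (val t) i).2).
Proof.
move=> i0 j0; have := extent_rank_spec t i0 (ltn_ord i); case: (extent _ _) => lo hi.
case=> /= /andP[lo1 loi] /andP[ihi hin] Hmin Hlo Hhi.
have ltin := ltn_ord i; have ltjn := ltn_ord j.
apply: (iffP idP) => [ltj l|H].
  by rewrite /between => lij; apply: Hmin; lia.
rewrite leqNgt; apply/andP; split.
  apply/negP => jlo; have lo_lt : lo.-1 < n.+1 by lia.
  have := H (Ordinal lo_lt); rewrite /between /rank /= => Hl.
  have := Hlo ltac:(lia); rewrite ltnNge Hl //; lia.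
rewrite ltnNge; apply/negP => hij; have hi_lt : hi < n.+1 by lia.
have := H (Ordinal hi_lt); rewrite /between /rank /= => Hl.
have := Hhi ltac:(lia); rewrite ltnNge Hl //; lia.
Qed.

Lemma forget_n_painted t : n_painted t = n_levels (@painted _ _) (val (forget t)).
Proof.
rewrite /n_painted /n_levels /= levels_map /levels; congr (size (undup _)).
by apply: eq_pmap; case.
Qed.

(** The cut-off at [(n_painted t).+1] identifies exactly the ranks of unpainted nodes, whose levels
    are forgotten. *)
Lemma forget_rank_eq t s : forget t = forget s ->
  n_painted t = n_painted s /\
  forall i, minn (rank t i) (n_painted t).+1 = minn (rank s i) (n_painted t).+1.
Proof.
move=> E; have Em : n_painted t = n_painted s by rewrite !forget_n_painted E.
split=> // -[[|p] ltp]; rewrite /rank /=; first by rewrite Em.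
have /(congr1 (fun u => nth HalfPainted (gaps u) p)) : val (forget t) = val (forget s).
  by rewrite E.
rewrite /= !gaps_map !(nth_map HalfPainted) ?W_size // -Em.
case: (nth _ _ p) => [k||k]; case: (nth _ _ p) => [l||l] //=; first by case=> ->.
lia.
Qed.

(** By [rank_extentP] the hypothesis concerns an extent, and extents depend only on the shape of the
    tree, which [forget] keeps. *)
Lemma forget_above t s (i j : 'I_n.+1) : forget t = forget s -> 0 < i -> 0 < j ->
  (forall l : 'I_n.+1, between l i j -> rank t i <= rank t l) ->
  (forall l : 'I_n.+1, between l i j -> rank s i <= rank s l).
Proof.
move=> E i0 j0 /(rank_extentP t i0 j0) H; apply/(rank_extentP s i0 j0).
have := extent_map forget_unpainted (val t) i.
rewrite -[tree_map _ _]/(val (forget t)) E /= extent_map => ->; exact: H.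
Qed.

End ForgetRank.

(** * What the valley tubes on the fan see of a ranking *)

Section FanTubes.

Variable n : nat.
Implicit Types (A : {set 'I_n.+1}) (h : 'I_n.+1 -> nat) (i j l : 'I_n.+1).
Notation fan := (@fan n).
Notation q h := (valley_tubes fan h).

Lemma fan0 i : 0 < i -> fan ord0 i.
Proof. by move=> i0; rewrite /Defs.fan i0 /= ?orbT. Qed.

Lemma fan_tubeT : tube fan setT.
Proof.
apply/tubeP; split; first by apply/set0Pn; exists ord0.
have c i : connect [rel u v in setT | fan u v] ord0 i.
  have [i0|i0] := posnP i; first by rewrite (_ : i = ord0) ?connect0 //; apply: val_inj.
  by apply: connect1; rewrite /= !inE fan0.
have sy : connect_sym [rel u v in setT | fan u v].
  by apply: sym_connect_sym => x y /=; rewrite fan_sym !inE.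
by move=> x y _ _; apply: connect_trans (c y); rewrite sy.
Qed.

Lemma fan_pos i j : 0 < i -> 0 < j -> fan i j = (j == i.+1 :> nat) || (i == j.+1 :> nat).
Proof. by rewrite /Defs.fan => i0 j0; rewrite !(gtn_eqF i0, gtn_eqF j0) i0 j0 /= orbF. Qed.

Lemma tube_convex A (a b l : 'I_n.+1) : tube fan A -> ord0 \notin A ->
  a \in A -> b \in A -> a <= l <= b -> l \in A.
Proof.
move=> tA A0 aA bA /andP[al lb].
have pos i : i \in A -> 0 < i.
  rewrite lt0n; apply: contraL => /eqP i0; rewrite (_ : i = ord0) //; exact: val_inj.
case: (ltngtP a l) al => // [al _|al _]; last by rewrite -(ord_inj al).
have [||u [v [uA vA]]] := tube_exit (B := [set x : 'I_n.+1 | x < l]) tA aA bA; rewrite ?inE //.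
  by rewrite -leqNgt.
rewrite fan_pos ?pos // -leqNgt => uv ul lv.
by rewrite (_ : l = v) //; apply: val_inj => /=; lia.
Qed.

(** A valley tube containing [i] must contain 0, which is otherwise a neighbour of too large rank.
    Every node outside the tube is then adjacent to it and so has rank below [h i]. *)
Lemma leq_rank_low h i j : h i <= h ord0 ->
  (h i <= h j) = (tubes_at (q h) i \subset tubes_at (q h) j).
Proof.
move=> hi0; apply/idP/idP; last by apply: leq_tubes_at; apply: fan_sym.
move=> hij; apply/subsetP => A; rewrite !in_tubes_at => /andP[AU iA]; rewrite AU /=.
have /valley_tubesP[tA HA] := AU.
have A0 : ord0 \in A.
  apply: contraLR hi0 => A0; rewrite -ltnNge; apply: (HA _ _ i) => //.
  rewrite fan_sym fan0 // lt0n; apply: contraNneq A0 => i0.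
  by rewrite (_ : ord0 = i) //; apply: val_inj.
apply: contraLR hij => jA; rewrite -ltnNge; apply: (HA _ _ ord0) => //.
rewrite fan0 // lt0n; apply: contraNneq jA => j0.
by rewrite (_ : j = ord0) //; apply: val_inj.
Qed.

(** A valley tube containing [i] cannot stop on the way to [j]: the first node left out would have
    rank below [h i]. *)
Lemma above_tubesP h i j : 0 < i -> 0 < j ->
  (forall l, between l i j -> h i <= h l) <->
  (forall l, between l i j -> tubes_at (q h) i \subset tubes_at (q h) l).
Proof.
move=> i0 j0; split=> H l lij; last by apply: (leq_tubes_at (@fan_sym n)); apply: H.
apply/subsetP => A; rewrite !in_tubes_at => /andP[AU iA]; rewrite AU /=.
have /valley_tubesP[tA HA] := AU.
have ltin := ltn_ord i; have ltjn := ltn_ord j; have ltln := ltn_ord l.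
have step (k k' : 'I_n.+1) : k \in A -> 0 < k -> 0 < k' -> fan k k' -> between k' i j -> k' \in A.
  move=> kA k0 k'0 kk' bk'; apply/contraT => k'A.
  by have := HA k' i k k'A kA kk' iA; rewrite ltnNge H.
case: (leqP i l) => il.
  have [d Ed] : exists d, i + d = l by exists (l - i); lia.
  elim: d l Ed lij {ltln il} => [|d IH] l Ed lij.
    by rewrite (_ : l = i) //; apply: val_inj => /=; lia.
  have ltk : i + d < n.+1 by have := ltn_ord l; lia.
  apply: (step (Ordinal ltk)) => //=; try lia.
  - by apply: IH => //=; move: lij; rewrite /between /=; lia.
  - by rewrite fan_pos /=; lia.
have [d Ed] : exists d, l + d = i by exists (i - l); lia.
elim: d l Ed lij {ltln il} => [|d IH] l Ed lij.
  by rewrite (_ : l = i) //; apply: val_inj => /=; lia.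
have ltk : l.+1 < n.+1 by lia.
apply: (step (Ordinal ltk)) => //=; try (move: lij; rewrite /between; lia).
- by apply: IH => //=; move: lij; rewrite /between /=; lia.
- by rewrite fan_pos /=; move: lij; rewrite /between /=; lia.
Qed.

(** A comparison with a neighbour of rank at most that of 0 survives the cut-off in
    [forget_rank_eq]. In the remaining case the tube avoids 0, so it is an interval, and the
    comparison is read off extents. *)
Lemma forget_valley_sub (t s : W n) : forget t = forget s ->
  q (rank t) \subset q (rank s).
Proof.
move=> E; have [Em Emin] := forget_rank_eq E.
have t0 : rank t ord0 = n_painted t by [].
have s0 : rank s ord0 = n_painted t by rewrite Em.
apply/subsetP => A /valley_tubesP[tA HA]; apply/valley_tubesP; split=> // i j l iA lA eli jA.
have tij := HA i j l iA lA eli jA; have Ei := Emin i; have Ej := Emin j.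
have [low|high] := leqP (rank t i) (n_painted t); first by lia.
have A0 : ord0 \notin A.
  by apply/negP => A0; have := HA i ord0 l iA lA eli A0; rewrite t0; lia.
have pos (k : 'I_n.+1) : n_painted t < rank t k -> 0 < k.
  by rewrite lt0n -t0 => tk; apply: contraTneq tk => k0; rewrite (_ : k = ord0) ?ltnn //; apply: val_inj.
have i0 := pos _ high; have j0 : 0 < j by apply: pos; lia.
have l0 : 0 < l by rewrite lt0n; apply: contraNneq A0 => l0; rewrite (_ : ord0 = l) //; apply: val_inj.
(* [i] is next to an end of the interval [A], so all nodes from [i] to [j] other than [i] lie in
   [A]. *)
have Rt (k : 'I_n.+1) : between k i j -> rank t i <= rank t k.
  move=> kij; have [->//|ki] := eqVneq k i; have {}ki : k != i :> nat by [].
  apply/ltnW/(HA i k l) => //.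
  move: eli; rewrite fan_pos // => eli.
  have nij a b : a \in A -> b \in A -> ~~ (a <= i <= b).
    by move=> aA bA; apply: contra iA; apply: (tube_convex tA).
  have n1 := nij _ _ lA jA; have n2 := nij _ _ jA lA.
  have [ij|ji] := leqP i j.
    by apply: (tube_convex tA A0 lA jA); move: kij; rewrite /between; lia.
  by apply: (tube_convex tA A0 jA lA); move: kij; rewrite /between; lia.
have Rs := forget_above E i0 j0 Rt.
rewrite ltnNge; apply/negP => sji; move: tij; rewrite ltnNge => /negP; apply.
apply: (forget_above (esym E) j0 i0); last by rewrite /between; lia.
move=> k kji; apply: leq_trans sji (Rs _ _); move: kji; rewrite /between; lia.
Qed.

Lemma forget_valley (t s : W n) : forget t = forget s -> q (rank t) = q (rank s).
Proof. by move=> E; apply/eqP; rewrite eqEsubset !forget_valley_sub. Qed.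

(** As [g] skips no value, a node of value [k] has a chain of [k] strictly smaller values below it,
    and [h] increases strictly along the chain. *)
Lemma onto_low_leq N (g h : 'I_n.+1 -> nat) i : onto_levels N g ->
  (forall j k, g j <= g ord0 -> (g j <= g k) = (h j <= h k)) ->
  g i <= g ord0 -> g i <= h i.
Proof.
move=> [gN gonto] gh; move Ek: (g i) => k; elim: k i Ek => // k IH i Ek le0.
have [j Ej] : exists j, g j = k by apply: gonto; rewrite -ltnS -Ek ltnS ltnW.
have lej : g j <= g ord0 by rewrite Ej ltnW.
apply: leq_ltn_trans (IH j Ej _) _; first by rewrite -Ej.
by rewrite ltnNge -gh ?Ek // Ej ltnn.
Qed.

(** Labels are moved into [nat] because [ordered_gaps_inj] compares labels in an [eqType]. *)
Definition paint_code (a : paint nat unit) : nat :=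
  match a with Painted k => k.+2 | HalfPainted => 1 | Unpainted _ => 0 end.

Definition paint_decode (k : nat) : paint nat unit :=
  match k with 0 => Unpainted tt | 1 => HalfPainted | k.+2 => Painted _ k end.

Lemma paint_codeK : cancel paint_code paint_decode.
Proof. by case=> // -[]. Qed.

End FanTubes.

Lemma size_gaps_child (A : Type) (a : A) ts : 1 < size ts ->
  all (fun u => size (gaps u) < size (gaps (Node a ts))) ts.
Proof.
move=> szt; have := cons_gaps_node a (ltnW szt) => /(congr1 size).
move: (gaps _) => G /= szG.
suff: all (fun u => size (gaps u) + size ts <= (size G).+1) ts.
  by apply: sub_all => u; lia.
rewrite {}szG; elim: ts {szt} => //= t ts IH.
have le_ts : size ts <= size (flatten [seq a :: gaps u | u <- ts]).
  by elim: ts {IH} => //= u ts; rewrite size_cat; lia.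
rewrite size_cat; apply/andP; split; first by lia.
by apply: sub_all IH => u; lia.
Qed.

Lemma extents_size_le (A : Type) k (t : tree A) : plane t ->
  all (fun b => b.1.2 - b.1.1 <= size (gaps t)) (gaps (extents k t)).
Proof.
elim/tree_ind_all: t k => // a ts IH k /andP[szt plt].
rewrite extents_node all_gaps_node; last by case: (ts) szt => [|? []].
have := size_gaps_child a szt; move: (size (gaps (Node a ts))) => N szG.
rewrite /= addKn leqnn /=.
elim: ts k IH plt szG {szt} => //= t ts IHts k [IHt /IHts{}IHts].
case/andP=> pt /IHts{}IHts /andP[szt /IHts->]; rewrite andbT.
by apply: sub_all (IHt k pt) => b; lia.
Qed.

(** A child ends strictly fewer gaps at or above it than its parent. The widths thus order even the
    unpainted nodes, whose own labels have lost their levels. *)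
Lemma extents_ordered (A : Type) k (t : tree A) : plane t ->
  ordered (fun b c => c.1.2 - c.1.1 < b.1.2 - b.1.1) (extents k t).
Proof.
elim/tree_ind_all: t k => // a ts IH k /andP[szt plt].
rewrite extents_node.
have := size_gaps_child a szt; move: (size (gaps (Node a ts))) => N szG.
rewrite /= addKn.
elim: ts k IH plt szG {szt} => //= t ts IHts k [IHt /IHts{}IHts].
case/andP=> pt /IHts{}IHts /andP[szt /IHts{}IHts].
have /andP[-> ->] := IHts (k + size (gaps t)).+1; rewrite IHt // !andbT.
by apply: sub_all (extents_size_le k pt) => b /=; lia.
Qed.

(** * Recovering the forgotten tree from the tubing *)

Section Injectivity.

Variable n : nat.
Notation q h := (valley_tubes (@fan n) h).

(** The tubing fixes the low ranks ([leq_rank_low], [onto_low_leq]), hence the paint and painted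
    level at each gap. It also fixes every extent ([above_tubesP], [rank_extentP]), so the two trees
    labelled by extent and paint have the same gaps and coincide. *)
Lemma valley_forget (t s : W n) : q (rank t) = q (rank s) -> forget t = forget s.
Proof.
move=> E.
have to_low (u v : W n) i : q (rank u) = q (rank v) ->
    rank u i <= rank u ord0 -> rank v i <= rank v ord0.
  move=> Euv ui0; apply: (leq_tubes_at (@fan_sym n)).
  by rewrite -Euv -(@leq_rank_low _ (rank u) i ord0).
have low i j : rank t i <= rank t ord0 ->
    (rank t i <= rank t j) = (rank s i <= rank s j).
  move=> ti0; have si0 := to_low _ _ _ E ti0.
  by rewrite (@leq_rank_low _ _ i j ti0) (@leq_rank_low _ _ i j si0) E.
have low' i j : rank s i <= rank s ord0 ->
    (rank s i <= rank s j) = (rank t i <= rank t j).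
  by move=> si0; rewrite low //; apply: to_low si0.
have eq_low i : rank t i <= rank t ord0 -> rank t i = rank s i.
  move=> ti0; apply/eqP; rewrite eqn_leq (onto_low_leq (rank_onto t) low ti0).
  by rewrite (onto_low_leq (rank_onto s) low') // -low.
have Em : n_painted t = n_painted s by apply: (eq_low ord0).
have inext (i j : 'I_n.+1) : 0 < i -> 0 < j ->
    ((extent (val t) i).1 <= j < (extent (val t) i).2) =
    ((extent (val s) i).1 <= j < (extent (val s) i).2).
  move=> i0 j0; apply/(rank_extentP t i0 j0)/(rank_extentP s i0 j0) => H.
    by apply/(above_tubesP _ i0 j0); rewrite -E; apply/above_tubesP.
  by apply/(above_tubesP _ i0 j0); rewrite E; apply/above_tubesP.
have exteq i : 0 < i -> i < n.+1 -> extent (val t) i = extent (val s) i.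
  move=> i0 lti.
  have {}inext j : 0 < j -> j < n.+1 -> ((extent (val t) i).1 <= j < (extent (val t) i).2) =
    ((extent (val s) i).1 <= j < (extent (val s) i).2).
    by move=> j0 ltj; apply: (inext (Ordinal lti) (Ordinal ltj)).
  have [] := (extent_bounds t i0 lti, extent_bounds s i0 lti).
  case: (extent (val t) i) inext => lo hi; case: (extent (val s) i) => lo' hi' /= inext.
  move=> /andP[/andP[lo1 loi] /andP[ihi hin]] /andP[/andP[lo1' loi'] /andP[ihi' hin']].
  have A1 : lo <= lo' < hi by rewrite inext; lia.
  have A2 : lo' <= lo < hi' by rewrite -inext; lia.
  have A3 : lo <= hi'.-1 < hi by rewrite inext; lia.
  have A4 : lo' <= hi.-1 < hi' by rewrite -inext; lia.
  by clear inext; congr (_, _); lia.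
suff H : extents 1 (tree_map paint_code (val (forget t))) =
    extents 1 (tree_map paint_code (val (forget s))).
  apply: val_inj; have /(congr1 (tree_map paint_decode \o tree_map snd)) := H.
  rewrite /= !map_extents !tree_map_comp.
  by rewrite !(eq_tree_map (f := _ \o _) (g := forget_unpainted)) // => a /=; rewrite paint_codeK.
apply: (@ordered_gaps_inj _ (fun b c => c.1.2 - c.1.1 < b.1.2 - b.1.1)).
- by move=> a b; rewrite -leqNgt => /ltnW.
- by rewrite plane_extents /= !plane_map W_plane.
- by rewrite plane_extents /= !plane_map W_plane.
- by apply: extents_ordered; rewrite /= !plane_map W_plane.
- by apply: extents_ordered; rewrite /= !plane_map W_plane.
have szg u : size (gaps (extents 1 (tree_map paint_code (val (@forget n u))))) = n.
  by rewrite size_extents /= !gaps_map !size_map W_size.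
apply: (@eq_from_nth _ (0, 0, 0)) => [|p]; rewrite !szg // => ltp.
have nthE u : nth (0, 0, 0) (gaps (extents 1 (tree_map paint_code (val (@forget n u))))) p =
    (extent (val u) p.+1, paint_code (forget_unpainted (nth HalfPainted (gaps (val u)) p))).
  set T := tree_map _ _; apply/eqP; rewrite -pair_eqE /pair_eq; apply/andP; split; apply/eqP.
    rewrite -(nth_map _ (0, 0) fst) ?szg // -[LHS]/(extent T p.+1).
    by rewrite /T /= !extent_map.
  rewrite -(nth_map _ 0 snd) ?szg // -gaps_map map_extents /T /= !gaps_map.
  by rewrite -map_comp (nth_map HalfPainted) ?W_size.
rewrite !nthE exteq //; congr (_, _).
have eqp := eq_low (Ordinal (ltp : p.+1 < n.+1)).
have lowp := @to_low s t (Ordinal (ltp : p.+1 < n.+1)) (esym E).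
have ltk k := @painted_lt _ t p k ltp; have ltl l := @painted_lt _ s p l ltp.
move: eqp lowp ltk ltl; rewrite /rank /= -Em.
case: (nth _ (gaps (val t)) p) => [k||k]; case: (nth _ (gaps (val s)) p) => [l||l] //= eqp lowp ltk ltl.
all: try have := ltk _ erefl.
all: try have := ltl _ erefl.
all: clear ltk ltl; lia.
Qed.

End Injectivity.

Lemma has_gaps_node (A : Type) (p : pred A) a ts : 1 < size ts ->
  has p (gaps (Node a ts)) = p a || has (fun t => has p (gaps t)) ts.
Proof.
move=> szt; apply: negb_inj; rewrite negb_or -!all_predC all_gaps_node //; congr andb.
by apply: eq_all => t /=; rewrite all_predC.
Qed.

(** * The isomorphism *)

Section Lift.

(** One choice of weak order for the unpainted nodes: the level is [d] plus the number of unpainted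
    nodes strictly below on the path to the root. *)
Fixpoint depth_levels d (x : tree (paint nat unit)) : tree (paint nat nat) :=
  if x is Node a ts then
    match a with
    | Painted k => Node (Painted _ k) (map (depth_levels d) ts)
    | HalfPainted => Node HalfPainted (map (depth_levels d) ts)
    | Unpainted _ => Node (Unpainted d) (map (depth_levels d.+1) ts)
    end
  else Leaf.

Lemma depth_levelsK d x : tree_map forget_unpainted (depth_levels d x) = x.
Proof.
elim/tree_ind_all: x d => // a ts IH d.
have H e : [seq tree_map forget_unpainted i | i <- map (depth_levels e) ts] = ts.
  by elim: ts IH => //= t ts IHts [IHt /IHts->]; rewrite IHt.
by case: a => [k||[]] /=; rewrite H.
Qed.

Lemma plane_depth_levels d x : plane (depth_levels d x) = plane x.
Proof. by rewrite -{2}(depth_levelsK d x) plane_map. Qed.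

Lemma depth_levels_ge d x : plane x ->
  all (fun a => oapp (leq d) true (unpainted a)) (gaps (depth_levels d x)).
Proof.
elim/tree_ind_all: x d => // a ts IH d /andP[szt plt].
have H e : d <= e -> all (fun t => all (fun a => oapp (leq d) true (unpainted a)) (gaps t))
    (map (depth_levels e) ts).
  move=> de; elim: ts IH plt {szt} => //= t ts IHts [IHt /IHts{}IHts] /andP[pt /IHts->].
  rewrite andbT; apply: sub_all (IHt e pt) => -[?||l] //=; exact: leq_trans.
by case: a => [k||[]]; rewrite all_gaps_node ?size_map // H //= leqnn.
Qed.

Lemma depth_levels_ordered d x : plane x ->
  ordered (fun a b => if (unpainted a, unpainted b) is (Some k, Some l) then k < l else true)
    (depth_levels d x).
Proof.
elim/tree_ind_all: x d => // a ts IH d /andP[szt plt].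
set r := (X in ordered X).
have H e : all (ordered r) (map (depth_levels e) ts).
  by elim: ts IH plt {szt} => //= t ts IHts [IHt /IHts{}IHts] /andP[pt /IHts->]; rewrite IHt.
case: a => [k||[]] /=; rewrite H andbT all_map.
- by elim: ts {IH szt plt H} => //= t ts ->; rewrite andbT; elim: (gaps _).
- by elim: ts {IH szt plt H} => //= t ts ->; rewrite andbT; elim: (gaps _).
elim: ts plt {IH szt H} => //= t ts IHts /andP[pt /IHts ->]; rewrite andbT.
apply: sub_all (depth_levels_ge d.+1 pt) => -[?||l] //=.
Qed.

(** The path from the root to an unpainted node of level [k] passes through an unpainted node of
    each level from [d] on. *)
Lemma depth_levels_down d x k l : plane x ->
  has (fun a => unpainted a == Some k) (gaps (depth_levels d x)) -> d <= l < k ->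
  has (fun a => unpainted a == Some l) (gaps (depth_levels d x)).
Proof.
elim/tree_ind_all: x d => // a ts IH d /andP[szt plt] + /andP[dl lk].
have H e : e <= l -> has (fun t => has (fun a => unpainted a == Some k) (gaps t)) (map (depth_levels e) ts) ->
   has (fun t => has (fun a => unpainted a == Some l) (gaps t)) (map (depth_levels e) ts).
  move=> el; elim: ts IH plt {szt} => //= t ts IHts [IHt /IHts{}IHts] /andP[pt /IHts{}IHts].
  case/orP => [/(IHt e pt)->//|/IHts->]; by rewrite ?el ?orbT.
case: a => [j||[]]; rewrite !has_gaps_node ?size_map //=; try exact: H.
rewrite !(inj_eq (@Some_inj _)) => /orP[/eqP|]; first by lia.
by case: (ltngtP d l) dl => [dl _ /(H _ dl)->|//|->_ _] //; rewrite orbT.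
Qed.

Lemma lift_subproof n (x : X n) : is_W n (depth_levels 0 (val x)).
Proof.
case: x => x /= /and3P[/andP[plx abv] szx wo].
set T := depth_levels 0 x; have ET : tree_map forget_unpainted T = x := depth_levelsK 0 x.
have plT : plane T by rewrite plane_depth_levels.
rewrite -ET leaves_map in szx; rewrite -ET all_above_map in abv.
have Dlev : levels (@painted _ _) (tree_map forget_unpainted T) = levels (@painted _ _) T.
  by rewrite levels_map /levels; apply: eq_pmap; case.
move: wo; rewrite /weak_order -ET Dlev all_above_map => /andP[dc wo].
rewrite /is_W /painted_tree plT szx /weak_order dc /=; apply/and3P; split.
- by apply: etrans abv; apply: eq_all_above => -[?||?] [?||?].
- by apply: etrans wo; apply: eq_all_above => -[?||?] [?||?].
rewrite all_aboveE // depth_levels_ordered // andbT; apply/down_closedP => k l.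
by rewrite !mem_levels // => kT lk; apply: (depth_levels_down plx kT).
Qed.

Definition lift n (x : X n) : W n := Sub _ (lift_subproof x).

Lemma liftK n (x : X n) : forget (lift x) = x.
Proof. by apply: val_inj; rewrite /= depth_levelsK. Qed.

End Lift.

(** * The element of [W n] with a given ranking *)

Section RankTree.

Variables (n : nat) (h : 'I_n.+1 -> nat).

Definition rank_tree : tree (paint nat nat) :=
  tree_map (unrank (squash h ord0)) (build n [seq squash h (inord k) | k <- iota 1 n]).

Let m := squash h ord0.
Let s := [seq squash h (inord k) | k <- iota 1 n].

Lemma rank_tree_spec : [/\ plane rank_tree,
  ordered (fun a b => rank_label m a < rank_label m b) rank_tree
  & gaps rank_tree = map (unrank m) s].
Proof.
have [] := @buildP n s; first by rewrite size_map size_iota.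
move=> pl ord gE; rewrite plane_map gaps_map ordered_map gE; split=> //.
apply: etrans ord; apply: (@eq_in_ordered _ predT) => //; first exact: all_predT.
by move=> a b _ _; rewrite !unrankK.
Qed.

Lemma has_rank_tree (p : pred (paint nat nat)) :
  reflect (exists2 i : 'I_n.+1, 0 < i & p (unrank m (squash h i))) (has p (gaps rank_tree)).
Proof.
have [_ _ ->] := rank_tree_spec; rewrite has_map has_map; apply: (iffP hasP) => -[k].
  rewrite mem_iota add1n => /andP[k0 kn] pk; exists (inord k) => //.
  by rewrite inordK.
by move=> k0 pk; exists (k : nat) => /=; rewrite ?mem_iota ?inord_val // k0 add1n ltn_ord.
Qed.

Lemma mem_rank_tree_painted k :
  (k \in levels (@painted _ _) rank_tree) = (k < m).
Proof.
have [pl _ _] := rank_tree_spec; rewrite mem_levels //.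
apply/has_rank_tree/idP => [[i _]|km]; first by rewrite painted_unrank => /andP[].
have [i Ei] := squash_onto km; exists i; last by rewrite painted_unrank Ei eqxx.
by rewrite lt0n; apply: contraTneq km => i0; rewrite -Ei (_ : i = ord0) ?ltnn //; apply: val_inj.
Qed.

Lemma rank_tree_painted : n_levels (@painted _ _) rank_tree = m.
Proof.
have dc : down_closed (levels (@painted _ _) rank_tree).
  by move=> k l; rewrite !mem_rank_tree_painted => km /ltn_trans; apply.
have H k : (k < n_levels (@painted _ _) rank_tree) = (k < m).
  by rewrite -mem_rank_tree_painted mem_down_closed.
apply/eqP; rewrite eqn_leq; apply/andP; split.
  by rewrite leqNgt H ltnn.
by rewrite leqNgt -H ltnn.
Qed.

Lemma rank_tree_subproof : is_W n rank_tree.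
Proof.
have [pl ord gE] := rank_tree_spec; apply/is_WP; split=> //.
- by rewrite gE !size_map size_iota.
- by move=> k l; rewrite !mem_rank_tree_painted => km /ltn_trans; apply.
- move=> k l; rewrite !mem_levels // => /has_rank_tree[i i0].
  rewrite unpainted_unrank => /eqP Ei lk; apply/has_rank_tree.
  have [|j Ej] := @squash_onto _ h i (m.+1 + l); first by rewrite Ei ltn_add2l.
  exists j; last by rewrite unpainted_unrank Ej.
  rewrite lt0n; apply/eqP => j0; have : squash h j = m by congr squash; apply: val_inj.
  by rewrite Ej; lia.
by rewrite rank_tree_painted.
Qed.

Definition rank_W : W n := Sub _ rank_tree_subproof.

Lemma rank_rank_W i : rank rank_W i = squash h i.
Proof.
have [_ _ gE] := rank_tree_spec; rewrite /rank.
have Em : n_painted rank_W = m by apply: rank_tree_painted.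
case: (posnP i) => [i0|i0].
  by rewrite i0 /= Em /m; congr squash; apply: val_inj.
rewrite gap_rankS // Em [val _]/= gE.
have lti : i.-1 < n by rewrite -ltnS prednK.
rewrite (nth_map 0) ?size_map ?size_iota // unrankK (nth_map 0) ?size_iota //.
by rewrite nth_iota // add1n prednK // inord_val.
Qed.

Lemma rank_W_lt i j : (rank rank_W i < rank rank_W j) = (h i < h j).
Proof. by rewrite !rank_rank_W squash_lt. Qed.

End RankTree.

Section Isomorphism.

Variable n : nat.
Notation q h := (valley_tubes (@fan n) h).
Implicit Types (U V : Tub (@fan n)) (x y : X n).

Definition tubes_count (U : {set {set 'I_n.+1}}) (i : 'I_n.+1) : nat := #|tubes_at U i|.

Definition tree_of_tubing U : X n := forget (rank_W (tubes_count (val U))).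

Definition tubing_of_tree x : Tub (@fan n) :=
  Sub _ (valley_tubes_tubing (@fan_sym n) (rank (lift x)) (fan_tubeT n)).

Lemma tubing_of_forget (t : W n) : val (tubing_of_tree (forget t)) = q (rank t).
Proof. by apply: forget_valley; rewrite liftK. Qed.

Lemma valley_rank_W h : q (rank (rank_W h)) = q h.
Proof. by apply: eq_valley_tubes => i j; apply: rank_W_lt. Qed.

Lemma valley_tubes_count U : q (tubes_count (val U)) = val U.
Proof.
apply: valley_tubes_compat => //; first exact: fan_sym.
- exact: valP.
- by move=> i j; apply: subset_leq_card.
- by move=> i j; apply: proper_card.
Qed.

Lemma tree_of_tubingK : cancel tree_of_tubing tubing_of_tree.
Proof.
by move=> U; apply: val_inj; rewrite tubing_of_forget valley_rank_W valley_tubes_count.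
Qed.

Lemma tubing_of_treeK : cancel tubing_of_tree tree_of_tubing.
Proof.
move=> x; rewrite -[RHS]liftK; apply: valley_forget.
by rewrite valley_rank_W valley_tubes_count.
Qed.

Lemma growth_step_sub x y : growth_step x y ->
  val (tubing_of_tree x) \subset val (tubing_of_tree y).
Proof.
case=> t [s [<- <- /refines_rankP ref]]; rewrite !tubing_of_forget.
exact: valley_tubes_sub.
Qed.

Lemma growth_le_sub x y : growth_le y x ->
  val (tubing_of_tree x) \subset val (tubing_of_tree y).
Proof.
by elim=> [? ? /growth_step_sub//|//|a b c _ ab _]; apply: subset_trans.
Qed.

(** Ranking by [V] first and by [U] second refines the ranking by [V]. Since [V] lies in [U], it is
    also strictly monotone in the set of tubes of [U] at a node, so its valley tubes are [U]. *)
Lemma tub_le_growth_step U V : tub_le U V ->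
  growth_step (tree_of_tubing V) (tree_of_tubing U).
Proof.
rewrite /tub_le => VU.
(* A lexicographic rank: a count of tubes of [U] is less than the factor [#|val U|.+1]. *)
pose h i := tubes_count (val V) i * #|val U|.+1 + tubes_count (val U) i.
have cle i : tubes_count (val U) i <= #|val U|.
  by apply: subset_leq_card; apply/subsetP => A; rewrite in_tubes_at => /andP[].
have Vsub i j : tubes_at (val U) i \subset tubes_at (val U) j ->
    tubes_count (val V) i <= tubes_count (val V) j.
  move=> ij; apply: subset_leq_card; apply/subsetP => A; rewrite !in_tubes_at.
  case/andP=> AV iA; have := subsetP ij A; rewrite !in_tubes_at (subsetP VU _ AV) iA AV /=.
  exact.
exists (rank_W (tubes_count (val V))), (rank_W h); split=> //.
  apply: valley_forget; rewrite !valley_rank_W valley_tubes_count.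
  apply: valley_tubes_compat => //; first exact: fan_sym.
  - exact: valP.
  - move=> i j ij; apply: leq_add; last exact: subset_leq_card.
    by rewrite leq_mul2r Vsub ?orbT.
  - move=> i j ij; rewrite /h -addnS; apply: leq_add; last exact: proper_card.
    by rewrite leq_mul2r Vsub ?orbT // proper_sub.
apply/refines_rankP => i j; rewrite !rank_W_lt => ij; rewrite /h.
have := leq_mul ij (leqnn #|val U|.+1); rewrite mulSn; have := cle i; lia.
Qed.

End Isomorphism.

Theorem theorem4p16 (n : nat) (n_ge1 : 1 <= n) :
  exists f : Tub (@fan n) -> X n,
    bijective f /\
    (forall U U' : Tub (@fan n), tub_le U U' <-> growth_le (f U) (f U')).
Proof.
exists (@tree_of_tubing n); split.
  exact: Bijective (@tree_of_tubingK n) (@tubing_of_treeK n).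
move=> U V; split=> [/tub_le_growth_step|/growth_le_sub]; first exact: rt_step.
by rewrite !tree_of_tubingK.
Qed.
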